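(* Let $B=B(b_1,\dots,b_n)$ be a Ferrers board. Then, as an identity in $z$, $$\sum_{k=0}^n r_{n-k}(a,b;q,p;B)\prod_{j=1}^k[z-j+1]_{aq^{2(j-1)},\,bq^{j-1};q,p}=\prod_{i=1}^n[z+b_i-i+1]_{aq^{2(i-1-b_i)},\,bq^{i-1-b_i};q,p}.$$
   Context: Theta functions: for $x\neq 0$ and $|p|<1$, $\theta(x;p)=\prod_{j\ge0}(1-p^jx)(1-p^{j+1}/x)$, $\theta(x_1,\dots,x_m;p)=\prod_l\theta(x_l;p)$. For nonzero complex $a,b,q$ (generic, so that no denominator vanishes) define the small weight $w_{a,b;q,p}(k)=\frac{\theta(aq^{2k+1},bq^{k},aq^{k-2}/b;p)}{\theta(aq^{2k-1},bq^{k+2},aq^{k}/b;p)}\,q$ and the elliptic number $[z]_{a,b;q,p}=\frac{\theta(q^z,aq^z,bq^2,a/b;p)}{\theta(q,aq,bq^{z+1},aq^{z-1}/b;p)}$; a subscript like $[x]_{aq^{2s},bq^s;q,p}$ means $(a,b)$ replaced by $(aq^{2s},bq^s)$. Cells $(i,j)$: column $i$ from the left, row $j$ from the bottom. For nonnegative integers $b_1\le\dots\le b_n$, the Ferrers board is $B(b_1,\dots,b_n)=\{(i,j):1\le i\le n,1\le j\le b_i\}$. $\mathcal N_k(B)$ is the set of placements of $k$ nonattacking rooks in $B$ (no two in a common row or column). Each rook cancels all cells of $B$ strictly to its right in its row and strictly below it in its column. For $P\in\mathcal N_k(B)$, $U_B(P)$ is the set of cells of $B$ neither cancelled nor occupied,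 and $r_{(i,j)}(P)$ is the number of rooks of $P$ in cells $(i',j')$ with $i'<i$, $j'>j$. The elliptic rook numbers are $r_k(a,b;q,p;B)=\sum_{P\in\mathcal N_k(B)}\prod_{(i,j)\in U_B(P)}w_{a,b;q,p}\big(i-j-r_{(i,j)}(P)\big)$. *)

(* Defs.v *)
From HB Require Import structures.
From mathcomp Require Import all_boot all_order all_algebra.
From mathcomp Require Import finmap.
From mathcomp Require Import all_classical all_reals all_analysis.
From mathcomp Require Import complex.

Set Implicit Arguments.
Unset Strict Implicit.
Unset Printing Implicit Defensive.

Import Order.TTheory GRing.Theory Num.Theory.
Import numFieldNormedType.Exports.

Local Open Scope ring_scope.
Local Open Scope complex_scope.

Section EllipticNumbers.
Variable R : realType.
Local Notation C := R[i].

Definition cexp (z : C) : C :=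
  (expR (complex.Re z))%:C * (cos (complex.Im z) +i* sin (complex.Im z)).

(* The power [q^z], for the determination of [log q] given by [lam]. *)
Definition cpow (lam z : C) : C := cexp (lam * z).

(* [C^o] carries the topology of the numeric field [C]. *)
Definition theta1 (p x : C) : C :=
  lim ((fun N : nat =>
          \prod_(0 <= j < N) ((1 - p ^+ j * x) * (1 - p ^+ j.+1 / x)) : C^o)
       @ \oo)%classic.

Definition theta (p : C) (xs : seq C) : C := \prod_(x <- xs) theta1 p x.

Definition weight_num (a b q p : C) (k : int) : C :=
  theta p [:: a * q ^ (2 * k + 1); b * q ^ k; a * q ^ (k - 2) / b].

Definition weight_den (a b q p : C) (k : int) : C :=
  theta p [:: a * q ^ (2 * k - 1); b * q ^ (k + 2); a * q ^ k / b].

Definition weight (a b q p : C) (k : int) : C :=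
  weight_num a b q p k / weight_den a b q p k * q.

(* The elliptic number [z]_{a,b;q,p} with [q = cexp lam]; complex powers of
   [q] are taken with respect to [lam]. *)
Definition elliptic_num (lam a b q p z : C) : C :=
  theta p [:: cpow lam z; a * cpow lam z; b * q ^+ 2; a / b].

Definition elliptic_den (lam a b q p z : C) : C :=
  theta p [:: q; a * q; b * cpow lam (z + 1); a * cpow lam (z - 1) / b].

Definition elliptic_number (lam a b q p z : C) : C :=
  elliptic_num lam a b q p z / elliptic_den lam a b q p z.

(* [z]_{a q^{2s}, b q^s; q, p}, and its denominator *)
Definition shifted_elliptic_number (lam a b q p : C) (s : int) (z : C) : C :=
  elliptic_number lam (a * q ^ (2 * s)) (b * q ^ s) q p z.

Definition shifted_elliptic_den (lam a b q p : C) (s : int) (z : C) : C :=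
  elliptic_den lam (a * q ^ (2 * s)) (b * q ^ s) q p z.

End EllipticNumbers.

Section Rooks.
Local Open Scope fset_scope.

(* (column from the left, row from the bottom), both counted from 1 *)
Definition cell : Type := (nat * nat)%type.

(* B(h 1, ..., h n); the values of [h] outside 1..n play no role. *)
Definition ferrers (n : nat) (h : nat -> nat) : {fset cell} :=
  [fset c in [seq (i, j) | i <- iota 1 n, j <- iota 1 (h i)]].

Definition nonattacking (P : {fset cell}) : bool :=
  [forall c : P, forall d : P, (c != d) ==>
     (((val c).1 != (val d).1) && ((val c).2 != (val d).2))].

Definition placements (k : nat) (B : {fset cell}) : {fset {fset cell}} :=
  [fset P in fpowerset B | nonattacking P && (#|` P| == k)].

Definition cancels (d c : cell) : bool :=
  ((d.2 == c.2) && (d.1 < c.1)%N) || ((d.1 == c.1) && (c.2 < d.2)%N).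

Definition uncancelled (B P : {fset cell}) : {fset cell} :=
  [fset c in B | (c \notin P) && ~~ [exists d : P, cancels (val d) c]].

Definition rooks_nw (P : {fset cell}) (c : cell) : nat :=
  #|` [fset d in P | (d.1 < c.1)%N && (c.2 < d.2)%N]|.

Definition weight_arg (P : {fset cell}) (c : cell) : int :=
  c.1%:Z - c.2%:Z - (rooks_nw P c)%:Z.

Definition elliptic_rook (R : realType) (a b q p : R[i]) (k : nat)
    (B : {fset cell}) : R[i] :=
  \sum_(P <- placements k B)
    \prod_(c <- uncancelled B P) weight a b q p (weight_arg P c).

End Rooks.

(* Main.v *)
Require Import Defs.
From HB Require Import structures.
From mathcomp Require Import all_boot all_order all_algebra.
From mathcomp Require Import finmap.
From mathcomp Require Import all_classical all_reals all_analysis.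
From mathcomp Require Import complex.
From mathcomp Require Import ring lra zify.
Import Order.TTheory GRing.Theory Num.Theory.
Import numFieldNormedType.Exports.
Local Open Scope ring_scope.
Local Open Scope complex_scope.

Set Implicit Arguments.
Unset Strict Implicit.

(** The sum runs over all nonattacking placements [P] of the first [n] columns.
Adding a column of height [h], the weights met from the top of that column down
are [w(n+1-h), w(n+2-h), ...], whatever the rows cancelled by [P], and the
column contributes a telescoping sum for the recursion
[E_s = 1 + w(s+1) E_(s+1)] with [E_s = [z-s]_(aq^(2s),bq^s)]; hence it multiplies
the total by [E_(n-h)].  The recursion for [E_s] is Weierstrass' three-term
addition formula for [theta].

The addition formula is a Pluecker relation: by the Jacobi triple product,
[theta(xy) theta(x/y)] is, up to a constant, the 2x2 determinant
[x (beta(x) alpha(y) - alpha(x) beta(y))] with [alpha(x) = sum p^(s^2) x^(2s)]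
and [beta(x) = sum p^(s^2+s) x^(2s+1)].  Truncating [alpha] and [beta] keeps the
Pluecker relation exact, so only the convergence of the truncated determinants
to [theta(xy) theta(x/y)] is needed. *)

Local Notation normc := Normc.normc.

(** * Limits in R[i] *)

Section ComplexLimits.
Variable R : realType.
Local Notation C := R[i].

Lemma normr_normc (z : C) : `|z| = (normc z)%:C.
Proof. by []. Qed.

Lemma normc_ge0 (z : C) : 0 <= normc z.
Proof. by case: z => x y; exact: sqrtr_ge0. Qed.

Lemma normcX (z : C) n : normc (z ^+ n) = normc z ^+ n.
Proof. by elim: n => [|n IH]; rewrite ?Normc.normc1 // !exprS Normc.normcM IH. Qed.

Lemma normc_gt0 (z : C) : z != 0 -> 0 < normc z.
Proof.
move=> z0; rewrite lt_neqAle normc_ge0 andbT eq_sym.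
by apply: contra z0 => /eqP/Normc.eq0_normc ->.
Qed.

Lemma normcXz (z : C) (k : int) : normc (z ^ k) = normc z ^ k.
Proof. by case: k => n; rewrite ?NegzE -?exprnN ?Normc.normcV normcX. Qed.

Lemma normc_le_sum I (s : seq I) (P : pred I) (F : I -> C) :
  normc (\sum_(i <- s | P i) F i) <= \sum_(i <- s | P i) normc (F i).
Proof.
elim/big_rec2: _ => [|i y1 y2 _ le12]; first by rewrite Normc.normc0.
by apply: le_trans (le_normcD _ _) _; rewrite lerD2l.
Qed.

Lemma normc_prod I (s : seq I) (P : pred I) (F : I -> C) :
  normc (\prod_(i <- s | P i) F i) = \prod_(i <- s | P i) normc (F i).
Proof.
elim/big_rec2: _ => [|i y1 y2 _ <-]; first by rewrite Normc.normc1.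
by rewrite Normc.normcM.
Qed.

Lemma cvgC0_squeeze (z : nat -> C) (e : nat -> R) :
  (forall n, normc (z n) <= e n) -> (e @ \oo --> (0 : R))%classic ->
  ((z : nat -> C^o) @ \oo --> (0 : C^o))%classic.
Proof.
move=> ze /cvgr0Pnorm_lt e0; apply/cvgr0Pnorm_lt => -[x y].
(* In the order of [R[i]] a positive epsilon is a positive real number, so a real bound [e]
   suffices. *)
rewrite ltcE /= => /andP[/eqP -> x0].
near=> n; rewrite normr_normc ltcR.
apply: (le_lt_trans (ze n)); apply: le_lt_trans (ler_norm _) _.
by near: n; exact: e0.
Unshelve. all: by end_near. Qed.

Lemma Re_le_normc (z : C) : `|complex.Re z| <= normc z.
Proof. by have := normc_ge_Re z; rewrite lecR. Qed.

Lemma Im_le_normc (z : C) : `|complex.Im z| <= normc z.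
Proof.
have := Re_le_normc (z * 'i%C); rewrite ReiNIm normrN => /le_trans; apply.
by rewrite Normc.normcM /= expr0n /= add0r expr1n sqrtr1 mulr1.
Qed.

Lemma normc_le_ReIm (z : C) : normc z <= `|complex.Re z| + `|complex.Im z|.
Proof.
case: z => x y /=; rewrite -[leRHS]ger0_norm ?addr_ge0 // -sqrtr_sqr.
rewrite ler_wsqrtr // sqrrD !real_normK ?num_real //.
by rewrite addrAC lerDl mulrn_wge0 // mulr_ge0.
Qed.

Lemma cvgR_cauchy (x : nat -> R) (e : nat -> R) :
  (forall n m, (n <= m)%N -> `|x m - x n| <= e n) ->
  (e @ \oo --> (0 : R))%classic -> cvgn x.
Proof.
move=> xe /cvgr0Pnorm_lt e0; apply/cauchy_cvgP/cauchy_exP => eps eps0.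
have [N _ /(_ N (leqnn N)) /= eN] := e0 _ eps0.
exists (x N); exists N => // n /= Nn; rewrite /ball /= distrC.
by apply: le_lt_trans (xe _ _ Nn) _; apply: le_lt_trans (ler_norm _) eN.
Qed.

(** Completeness of [R] is applied to real and imaginary parts separately, and the two limits are
    recombined. *)
Lemma cvgC_cauchy (z : nat -> C) (e : nat -> R) :
  (forall n m, (n <= m)%N -> normc (z m - z n) <= e n) ->
  (e @ \oo --> (0 : R))%classic -> cvgn (z : nat -> C^o).
Proof.
move=> ze e0.
have cRe : cvgn (fun n => complex.Re (z n)).
  apply: cvgR_cauchy e0 => n m /ze; apply: le_trans.
  by rewrite -raddfB; exact: Re_le_normc.
have cIm : cvgn (fun n => complex.Im (z n)).
  apply: cvgR_cauchy e0 => n m /ze; apply: le_trans.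
  by rewrite -raddfB; exact: Im_le_normc.
move: cRe cIm => /cvg_ex[x cRe] /cvg_ex[y cIm].
suff z0 : ((fun n => z n - (x +i* y) : C^o) @ \oo --> (0 : C^o))%classic.
  exact: cvgP ((@subr_cvg0 _ C^o _ _ _ (z : nat -> C^o) (x +i* y)).1 z0).
apply: (@cvgC0_squeeze _ (fun n =>
  `|complex.Re (z n) - x| + `|complex.Im (z n) - y|)) => [n|].
  by apply: le_trans (normc_le_ReIm _) _; rewrite !raddfB.
rewrite -[X in (_ --> X)%classic](addr0 0); apply: cvgD; apply/norm_cvg0P/subr_cvg0.
  exact: cRe.
exact: cIm.
Qed.
End ComplexLimits.

(** * Products and series with geometric bounds *)

Section Products.
Variable R : realType.
Local Notation C := R[i].

(** Since |1 + e_j| <= exp(c r^j), the partial products P_n stay below exp(c/(1-r)). Then P_(j+1) -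
    P_j = P_j e_j, and summing over j gives a geometric tail. One constant serves both bounds. *)
Lemma prod_geometric_cauchy (e : nat -> C) (c r : R) :
  0 <= c -> 0 <= r -> r < 1 -> (forall j, normc (e j) <= c * r ^+ j) ->
  exists M : R, [/\ 0 <= M,
    forall n, normc (\prod_(0 <= j < n) (1 + e j)) <= M &
    forall n m, (n <= m)%N ->
      normc (\prod_(0 <= j < m) (1 + e j) - \prod_(0 <= j < n) (1 + e j))
        <= M * r ^+ n].
Proof.
move=> c0 r0 r1 ec.
have geo n m : (\sum_(n <= j < m) r ^+ j) * (1 - r) <= r ^+ n.
  case: (leqP n m) => [nm|mn]; last first.
    by rewrite big_geq ?(ltnW mn) // mul0r exprn_ge0.
  rewrite -opprB mulrN -mulNr -sumrN mulr_suml.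
  rewrite (telescope_sumr_eq (fun j => - r ^+ j)) ?opprK //; last first.
    by move=> j _; rewrite exprS; ring.
  by rewrite addrC lerBlDr lerDl exprn_ge0.
have r1' : 0 < 1 - r by rewrite subr_gt0.
pose M0 := expR (c / (1 - r)).
have M00 : 0 <= M0 by exact: expR_ge0.
have bd n : normc (\prod_(0 <= j < n) (1 + e j)) <= M0.
  rewrite normc_prod.
  apply: (@le_trans _ _ (\prod_(0 <= j < n) expR (c * r ^+ j))).
    apply: ler_prod => j _; rewrite normc_ge0 /=.
    apply: le_trans (le_normcD _ _) _; rewrite Normc.normc1.
    by apply: le_trans (expR_ge1Dx _); rewrite lerD2l.
  rewrite -expR_sum ler_expR -mulr_sumr ler_wpM2l //.
  by rewrite -[leRHS]mul1r ler_pdivlMr // -(expr0 r); exact: geo.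
pose M1 := M0 * c / (1 - r).
have M10 : 0 <= M1 by rewrite mulr_ge0 ?invr_ge0 ?(ltW r1') // mulr_ge0.
exists (M0 + M1); split=> [|n|n m nm].
- by rewrite addr_ge0.
- by apply: le_trans (bd n) _; rewrite lerDl.
apply: (@le_trans _ _ (M1 * r ^+ n)); last first.
  by rewrite ler_wpM2r ?exprn_ge0 // lerDr.
rewrite -(telescope_sumr (fun n => \prod_(0 <= j < n) (1 + e j)) nm).
apply: le_trans (normc_le_sum _ _ _) _.
apply: (@le_trans _ _ (\sum_(n <= j < m) M0 * c * r ^+ j)).
  apply: ler_sum => j _; rewrite big_nat_recr //= mulrDr mulr1 addrAC subrr add0r.
  by rewrite Normc.normcM -mulrA ler_pM ?normc_ge0.
rewrite -mulr_sumr /M1 -!mulrA ler_wpM2l // ler_wpM2l //.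
by rewrite mulrC ler_pdivlMr.
Qed.

(** The ratio s r^k of consecutive terms is eventually at most 1/2. From there on a_k <= 2 a_k - 2
    a_(k+1), so the tail telescopes to at most 2 a_J. *)
Lemma gaussian_series_bounded (a : nat -> R) (s r : R) :
  0 <= s -> 0 <= r -> r < 1 -> (forall k, 0 <= a k) ->
  (forall k, a k.+1 = s * r ^+ k * a k) ->
  exists M : R, forall n, \sum_(0 <= k < n) a k <= M.
Proof.
move=> s0 r0 r1 a0 aS.
have [J sJ] : exists J, s * r ^+ J <= 2^-1.
  have /cvgr0Pnorm_lt/(_ 2^-1) : (geometric s r @ \oo --> (0 : R))%classic.
    by apply: cvg_geometric; rewrite ger0_norm.
  rewrite invr_gt0 => /(_ (ltr0Sn _ 1))[J _ /(_ J (leqnn J)) /=] sJ.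
  by exists J; apply: le_trans (ltW sJ); exact: ler_norm.
have aJ k : (J <= k)%N -> a k <= 2 * a k - 2 * a k.+1.
  move=> Jk; rewrite aS.
  suff: s * r ^+ k * a k <= 2^-1 * a k by lra.
  rewrite ler_wpM2r //; apply: le_trans sJ; rewrite ler_wpM2l //.
  by rewrite ler_wiXn2l // ltW.
exists (\sum_(0 <= k < J) a k + 2 * a J) => n.
case: (leqP n J) => [nJ|/ltnW Jn].
  apply: (@le_trans _ _ (\sum_(0 <= k < J) a k)); last first.
    by rewrite lerDl mulr_ge0.
  by rewrite (big_cat_nat (n := n) _ nJ) //= lerDl sumr_ge0.
rewrite (big_cat_nat (n := J)) //= lerD2l.
apply: (@le_trans _ _ (\sum_(J <= k < n) (2 * a k - 2 * a k.+1))).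
  by rewrite big_nat_cond [leRHS]big_nat_cond; apply: ler_sum => k /andP[/andP[/aJ]].
rewrite (telescope_sumr_eq (fun k => - (2 * a k))) //; last first.
  by move=> k _; rewrite opprK addrC.
by rewrite opprK addrC lerBlDr lerDl mulr_ge0.
Qed.
End Products.

(** * Jacobi triple product *)

Section SymmetricRange.
(** The window [-N, N]; two-sided series are handled through these symmetric truncations. *)
Definition zrange (N : nat) : seq int :=
  [seq i%:Z - N%:Z | i <- iota 0 N.*2.+1].

Lemma mem_zrange k N : (k \in zrange N) = (`|k| <= N)%N.
Proof.
apply/mapP/idP => [[j] | kN]; first by rewrite mem_iota => jN ->; lia.
by exists (absz (k + N%:Z)); rewrite ?mem_iota; lia.
Qed.

Lemma zrange_uniq N : uniq (zrange N).
Proof. by rewrite map_inj_uniq ?iota_uniq // => i j; lia. Qed.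

Lemma zrangeS N :
  perm_eq (zrange N.+1) [:: N.+1%:Z, - N.+1%:Z & zrange N].
Proof.
apply: uniq_perm => [| |k]; first exact: zrange_uniq.
  by rewrite 2!cons_uniq zrange_uniq in_cons !mem_zrange; lia.
by rewrite mem_zrange 2!in_cons mem_zrange; lia.
Qed.

Lemma zrange0 : zrange 0 = [:: 0].
Proof. by []. Qed.

(** The division is exact for every sign of k, as [tri_double] records. *)
Definition tri (k : int) : int := (k * (k - 1) %/ 2)%Z.

Lemma tri_double k : tri k * 2 = k * (k - 1).
Proof.
rewrite /tri divzK // dvdzE /= abszM dvdn2 oddM.
suff: ~~ odd `|k| || ~~ odd `|k - 1| by case: (odd _); case: (odd _).
by lia.
Qed.

Lemma tri0 : tri 0 = 0.
Proof. by []. Qed.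

Lemma triS k : tri (k + 1) = tri k + k.
Proof. by have := tri_double k; have := tri_double (k + 1); nia. Qed.
End SymmetricRange.

Section GaussianTerms.
Variable F : fieldType.
Implicit Types r x : F.

(** The term of the two-sided series in the Jacobi triple product. It is used at complex arguments
    for theta and at their absolute values for majorants. *)
Definition gterm r x (k : int) : F := r ^ tri k * x ^ k.
Definition gsum r x (N : nat) : F := \sum_(k <- zrange N) gterm r x k.

Lemma gterm0 r x : gterm r x 0 = 1.
Proof. by rewrite /gterm tri0 !expr0z mulr1. Qed.

Lemma gtermS r x k : r != 0 -> x != 0 ->
  gterm r x (k + 1) = r ^ k * x * gterm r x k.
Proof.
by move=> r0 x0; rewrite /gterm triS !expfzDr // expr1z; ring.
Qed.

Lemma gsumS r x N : gsum r x N.+1 =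
  gterm r x N.+1%:Z + gterm r x (- N.+1%:Z) + gsum r x N.
Proof. by rewrite /gsum (perm_big _ (zrangeS N)) 2!big_cons; exact: addrA. Qed.

Lemma gsumE r x N : gsum r x N =
  \sum_(0 <= k < N.+1) gterm r x k + \sum_(0 <= k < N) gterm r x (- k.+1%:Z).
Proof.
elim: N => [|N IH].
  rewrite /gsum zrange0 big_seq1 big_nat1 big_geq //. by rewrite addr0.
rewrite gsumS IH [in RHS]big_nat_recr //= [X in _ + X = _]addrC.
by rewrite [in X in _ = _ + X]big_nat_recr //=; ring.
Qed.

Lemma gterm_neg r x N : r != 0 -> x != 0 ->
  \prod_(0 <= j < N) (r ^+ j.+1 / x) = gterm r x (- N%:Z).
Proof.
move=> r0 x0; elim: N => [|N IH]; first by rewrite big_geq // gterm0.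
rewrite big_nat_recr //= IH.
have -> : - N%:Z = - N.+1%:Z + 1 by lia.
rewrite gtermS // -exprnN.
have : r ^+ N.+1 != 0 by rewrite expf_neq0.
by move=> h; field; rewrite h x0.
Qed.

(** Counting from the left end of the window, i = k + N, produces the exponents 'C(i, 2) of the
    q-binomial theorem, with argument x / r^N. *)
Lemma gterm_shift r x N i : r != 0 -> x != 0 ->
  gterm r x (i%:Z - N%:Z) =
    gterm r x (- N%:Z) * (r ^+ 'C(i, 2) * (x / r ^+ N) ^+ i).
Proof.
move=> r0 x0; elim: i => [|i IH]; first by rewrite sub0r !expr0 !mulr1.
have -> : i.+1%:Z - N%:Z = i%:Z - N%:Z + 1 by lia.
rewrite gtermS // IH binS bin1 exprD expfzDr // -exprnN -exprnP [in RHS]exprS.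
by ring.
Qed.
End GaussianTerms.

(** * Gaussian binomials and the finite triple product *)

Section GaussianBinomial.
Variable F : fieldType.
Variable p : F.

(** Gaussian binomial coefficients in base [p], given by a Pascal rule so that no division
    occurs. *)
Fixpoint qbin (n k : nat) : F :=
  match n, k with
  | _, 0 => 1
  | 0, _.+1 => 0
  | n'.+1, k'.+1 => p ^+ k'.+1 * qbin n' k'.+1 + qbin n' k'
  end.

Definition qfact n : F := \prod_(0 <= j < n) (1 - p ^+ j.+1).

Lemma qbinn0 n : qbin n 0 = 1.
Proof. by case: n. Qed.

Lemma qbinS n k : qbin n.+1 k.+1 = p ^+ k.+1 * qbin n k.+1 + qbin n k.
Proof. by []. Qed.

Lemma qbin_small n k : (n < k)%N -> qbin n k = 0.
Proof.
elim: n k => [|n IH] [|k] //= nk.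
by rewrite !IH ?mulr0 ?addr0 // ltnW.
Qed.

Lemma qbin_fact n k : (k <= n)%N -> qbin n k * qfact k * qfact (n - k) = qfact n.
Proof.
have q0 : qfact 0 = 1 by rewrite /qfact big_geq.
have qS m : qfact m.+1 = qfact m * (1 - p ^+ m.+1).
  by rewrite /qfact big_nat_recr.
elim: n k => [|n IH] [|k] // kn; rewrite ?qbinn0 ?subn0 ?q0 ?mul1r ?mulr1 //.
rewrite qbinS subSS !mulrDl.
have -> : qbin n k * qfact k.+1 * qfact (n - k) = (1 - p ^+ k.+1) * qfact n.
  by rewrite -(IH k) // qS; ring.
rewrite [qfact n.+1]qS; case: (ltnP k n) => [kn'|nk].
  rewrite -(subnSK kn') [qfact (n - k.+1).+1]qS -(IH k.+1) //.
  have -> : p ^+ n.+1 = p ^+ k.+1 * p ^+ (n - k.+1).+1.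
    by rewrite -exprD; congr (_ ^+ _); lia.
  by ring.
by rewrite qbin_small // (_ : n = k) ?mulr0 ?mul0r ?add0r; [ring | lia].
Qed.

(** The q-binomial theorem, by induction: splitting off the factor j = 0 leaves the product at pX,
    and comparing coefficients of X gives the Pascal rule of [qbin]. *)
Lemma qbinomial n X : \prod_(0 <= j < n) (1 + p ^+ j * X) =
  \sum_(0 <= i < n.+1) p ^+ 'C(i, 2) * qbin n i * X ^+ i.
Proof.
elim: n X => [|n IH] X.
  by rewrite big_geq // big_nat1 expr0 !mulr1.
rewrite big_nat_recl //= expr0 mul1r.
rewrite (eq_big_nat _ _ (F2 := fun j => 1 + p ^+ j * (p * X))); last first.
  by move=> j _; rewrite exprSr mulrA.
rewrite IH mulrDl mul1r mulr_sumr [in RHS]big_nat_recl //.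
rewrite [in RHS]bin0n !expr0 !mulr1.
under [in RHS]eq_bigr => i _ do rewrite binS bin1.
rewrite [in LHS]big_nat_recl // qbinn0 bin0n !expr0 !mulr1 -addrA; congr (_ + _).
have -> : \sum_(0 <= i < n.+1)
   p ^+ ('C(i, 2) + i) * (p ^+ i.+1 * qbin n i.+1 + qbin n i) * X ^+ i.+1 =
   \sum_(0 <= i < n.+1)
     p ^+ ('C(i, 2) + i) * p ^+ i.+1 * qbin n i.+1 * X ^+ i.+1 +
   \sum_(0 <= i < n.+1) X * (p ^+ 'C(i, 2) * qbin n i * (p * X) ^+ i).
  rewrite -big_split /=; apply: eq_bigr => i _.
  by rewrite exprD exprMn [X ^+ i.+1]exprS; ring.
congr (_ + _); rewrite [in RHS]big_nat_recr //= (qbin_small (ltnSn n)).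
rewrite mulr0 mul0r addr0; apply: eq_bigr => i _.
by rewrite binS bin1 !exprD exprMn !exprS; ring.
Qed.

(** Taking p^(j+1)/y out of each second factor leaves the q-binomial product of length 2N at y/p^N;
    the extracted factors multiply to the Gaussian term at -N. *)
Lemma finite_triple_product N y : p != 0 -> y != 0 ->
  \prod_(0 <= j < N) ((1 + p ^+ j * y) * (1 + p ^+ j.+1 / y)) =
  \sum_(k <- zrange N) qbin N.*2 (absz (k + N%:Z)) * gterm p y k.
Proof.
move=> p0 y0; rewrite /zrange big_map.
pose X := y / p ^+ N.
rewrite [RHS](eq_bigr (fun i : nat => gterm p y (- N%:Z) *
   (p ^+ 'C(i, 2) * qbin N.*2 i * X ^+ i))); last first.
  by move=> i _; rewrite gterm_shift // subrK absz_nat; ring.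
rewrite -mulr_sumr -[iota _ _]/(index_iota 0 N.*2.+1) -qbinomial.
rewrite -gterm_neg // -addnn.
(* Of the 2N factors, the first N, read backwards, absorb the extracted ones and become 1 +
   p^(j+1)/y; the last N are the 1 + p^j y. *)
rewrite [X in _ = _ * X](big_cat_nat (n := N)) ?leq_addr //= mulrA.
rewrite [X in _ = _ * X * _]big_nat_rev /= add0n -[X in _ = X * _]big_split /=.
rewrite [LHS]big_split /= [LHS]mulrC.
have pN0 n : p ^+ n != 0 by rewrite expf_neq0.
congr (_ * _).
  apply: eq_big_nat => j /andP[_ jN]; rewrite /X.
  have -> : p ^+ N = p ^+ (N - j.+1) * p ^+ j.+1 by rewrite -exprD subnK.
  by field; rewrite y0 !pN0.
rewrite -{2}(add0n N) big_addn addnK; apply: eq_bigr => j _; rewrite exprD /X.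
by field; rewrite pN0.
Qed.
End GaussianBinomial.

(** * Real Gaussian sums as majorants *)

Section GaussianSums.
Variable R : realType.
Implicit Types r t : R.

Lemma gterm_ge0 r t k : 0 <= r -> 0 <= t -> 0 <= gterm r t k.
Proof. by move=> r0 t0; rewrite mulr_ge0 // exprz_ge0. Qed.

Lemma gsum_ge0 r t N : 0 <= r -> 0 <= t -> 0 <= gsum r t N.
Proof. by move=> r0 t0; apply: sumr_ge0 => k _; exact: gterm_ge0. Qed.

Lemma gsum_homo r t : 0 <= r -> 0 <= t ->
  {homo gsum r t : m n / (m <= n)%N >-> m <= n}.
Proof.
move=> r0 t0; apply: homo_leq => // [? ? ? |N]; first exact: le_trans.
by rewrite gsumS lerDr addr_ge0 // gterm_ge0.
Qed.

(** Both halves of the sum have ratios of the form s r^k: s = t on the indices k >= 0, and s = r^2/t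
    on the indices -(k+1). *)
Lemma gsum_bounded r t : 0 < r -> r < 1 -> 0 < t ->
  exists M, forall N, gsum r t N <= M.
Proof.
move=> r0 r1 t0; have [r0' t0'] := (ltW r0, ltW t0).
have [rn0 tn0] : r != 0 /\ t != 0 by rewrite !gt_eqF.
have [k|k|M1 h1] := @gaussian_series_bounded _ (fun k => gterm r t k%:Z)
  t r t0' r0' r1; first exact: gterm_ge0.
  by rewrite -addn1 PoszD gtermS // -exprnP; ring.
have s0 : 0 <= r ^+ 2 / t by rewrite divr_ge0 // exprn_ge0.
have [k|k|M2 h2] := @gaussian_series_bounded _
  (fun k => gterm r t (- k.+1%:Z)) (r ^+ 2 / t) r s0 r0' r1.
- exact: gterm_ge0.
- have -> : - k.+1%:Z = - k.+2%:Z + 1 by lia.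
  rewrite gtermS // -exprnN.
  have h : r ^+ k.+2 != 0 by rewrite expf_neq0.
  have -> : r ^+ 2 / t * r ^+ k = r ^+ k.+2 / t by rewrite -(addn2 k) exprD; ring.
  by field; rewrite h tn0.
exists (M1 + M2) => N; rewrite gsumE lerD //.
Qed.

Lemma gsum_cvg r t : 0 < r -> r < 1 -> 0 < t -> cvgn (gsum r t).
Proof.
move=> r0 r1 t0; have [M gM] := gsum_bounded r0 r1 t0.
apply: nondecreasing_is_cvgn; first by apply: gsum_homo; exact: ltW.
by exists M => _ [N _ <-].
Qed.

Lemma normc_gterm (p x : R[i]) k : normc (gterm p x k) = gterm (normc p) (normc x) k.
Proof. by rewrite /gterm Normc.normcM !normcXz. Qed.
End GaussianSums.

(** Only indices of [B] outside [A] survive in the difference, and all of them lie in [A']. This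
    compares sums over windows of different shapes. *)
Lemma normc_sumB_nested (R : realType) (I : eqType) (A B A' : seq I) (f : I -> R[i]) :
  uniq A -> uniq B -> uniq A' -> {subset A <= B} -> {subset B <= A'} ->
  normc (\sum_(i <- B) f i - \sum_(i <- A) f i) <=
  \sum_(i <- A') normc (f i) - \sum_(i <- A) normc (f i).
Proof.
move=> uA uB uA' AB BA'.
have split_sub (V : nmodType) (g : I -> V) (L : seq I) : uniq L -> {subset A <= L} ->
    \sum_(i <- L) g i = \sum_(i <- A) g i + \sum_(i <- L | i \notin A) g i.
  move=> uL AL; rewrite (bigID (mem A)) /=; congr (_ + _).
  rewrite -big_filter; apply: perm_big; apply: uniq_perm => // [|i].
    exact: filter_uniq.
  by rewrite mem_filter; case: (boolP (i \in A)) => // /AL ->.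
rewrite (split_sub _ _ B) // (split_sub _ _ A') //; last by move=> i /AB/BA'.
rewrite addrC addKr [leRHS]addrC addKr.
apply: le_trans (normc_le_sum _ _ _) _.
rewrite -big_filter -[leRHS]big_filter.
rewrite [leRHS](bigID (mem B)) /=.
rewrite -[X in _ <= X + _]big_filter.
rewrite [X in _ <= X + _](perm_big [seq i <- B | i \notin A]); last first.
  apply: uniq_perm => [| |i]; try by do !apply: filter_uniq.
  rewrite !mem_filter.
  by case: (boolP (i \in B)) => [/BA' ->|]; rewrite ?andbF ?andbT.
by rewrite lerDl sumr_ge0 // => i _; exact: normc_ge0.
Qed.

(** * Theta products as 2x2 determinants *)

Section ThetaDeterminant.
Variable F : fieldType.
Implicit Types p x y : F.

(** [theta_even] and [theta_odd] truncate the series alpha and beta. *)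
Definition theta_even p x N : F := \sum_(s <- zrange N) p ^ (s * s) * x ^ (2 * s).
Definition theta_odd p x N : F :=
  \sum_(s <- zrange N) p ^ (s * s + s) * x ^ (2 * s + 1).
(** The factor [x] reflects theta(y/x) = -(y/x) theta(x/y): theta(xy) theta(x/y) becomes
    antisymmetric in x and y only after division by x. *)
Definition theta_det p x y N : F :=
  x * (theta_odd p x N * theta_even p y N - theta_even p x N * theta_odd p y N).

Definition square N : seq (int * int) := [seq (m, n) | m <- zrange N, n <- zrange N].
(** A window of pairs (m, n) in rotated coordinates s, t: m + n is even in the first list and odd in
    the second. *)
Definition parity_squares N : seq (int * int) :=
  [seq (s + 1 + t, s + 1 - t) | s <- zrange N, t <- zrange N] ++
  [seq (s + t + 1, s - t) | s <- zrange N, t <- zrange N].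

Lemma square_uniq N : uniq (square N).
Proof.
by apply: allpairs_uniq; rewrite ?zrange_uniq // => -[? ?] [? ?] _ _ []-> ->.
Qed.

Lemma mem_square m n N : ((m, n) \in square N) = (`|m| <= N)%N && (`|n| <= N)%N.
Proof.
rewrite -!mem_zrange; apply/allpairsP/andP => [[[? ?] /= [? ?]] [-> ->]|[? ?]] //.
by exists (m, n).
Qed.

Lemma parity_squares_uniq N : uniq (parity_squares N).
Proof.
rewrite cat_uniq; apply/and3P; split.
- apply: allpairs_uniq; rewrite ?zrange_uniq // => -[s t] [s' t'] _ _ /= [].
  by move=> h1 h2; congr (_, _); lia.
- apply/hasP => -[[m n]] /allpairsP[[s t] /= [_ _ [h1 h2]]] mn.
  have {mn} : (m, n) \in [seq (s + 1 + t, s + 1 - t) |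
    s <- zrange N, t <- zrange N] by [].
  by case/allpairsP => -[s' t'] /= [_ _ [h3 h4]]; lia.
- apply: allpairs_uniq; rewrite ?zrange_uniq // => -[s t] [s' t'] _ _ /= [].
  by move=> h1 h2; congr (_, _); lia.
Qed.

(** With [parity_sub_square], this encloses the rotated window between two squares, as
    [normc_sumB_nested] requires. *)
Lemma square_sub_parity N : {subset square N <= parity_squares N.+1}.
Proof.
move=> [m n]; rewrite mem_square => /andP[mN nN]; rewrite mem_cat; apply/orP.
case: (boolP (2 %| m + n)%Z) => [/dvdzP[k mn]|mn].
  (* Here s = k - 1 can reach -N-1, whence the size [N.+1]. *)
  left; apply/allpairsP; exists (k - 1, m - k) => /=.
  by split; rewrite ?mem_zrange; [lia|lia|congr (_, _); lia].
have [k {}mn] : exists k, m + n = k * 2 + 1 by exists (((m + n) %/ 2)%Z); lia.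
right; apply/allpairsP; exists (k, m - k - 1) => /=.
by split; rewrite ?mem_zrange; [lia|lia|congr (_, _); lia].
Qed.

Lemma parity_sub_square N : {subset parity_squares N <= square N.*2.+1}.
Proof.
move=> [m n]; rewrite mem_cat mem_square => /orP[] /allpairsP[[s t] /=];
  by rewrite !mem_zrange => -[? ? [-> ->]]; lia.
Qed.

Lemma sum_square (f g : int -> F) N :
  \sum_(c <- square N) f c.1 * g c.2 =
  (\sum_(m <- zrange N) f m) * (\sum_(n <- zrange N) g n).
Proof.
rewrite big_allpairs_dep mulr_suml; apply: eq_bigr => m _.
by rewrite mulr_sumr.
Qed.

(** In the coordinates s, t the exponents of p, x and y separate, so each list sums to a product of
    two single sums. The sign (-1)^(m+n) is + on the first list and - on the second, which yields
    the determinant. *)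
Lemma sum_parity_squares p x y N : p != 0 -> x != 0 -> y != 0 ->
  \sum_(c <- parity_squares N)
     gterm p (- (x * y)) c.1 * gterm p (- (x / y)) c.2 =
  theta_det p x y N.
Proof.
move=> p0 x0 y0; rewrite /parity_squares big_cat; rewrite 2!big_allpairs_dep.
have E m n : gterm p (- (x * y)) m * gterm p (- (x / y)) n =
    (- 1) ^ (m + n) * (p ^ (tri m + tri n) * (x ^ (m + n) * y ^ (m - n))).
  have N10 : -1 != 0 :> F by rewrite oppr_eq0 oner_eq0.
  rewrite /gterm -[- (x * y)]mulN1r -[- (x / y)]mulN1r !expfzMl.
  rewrite !(expfzDr _ _ N10) !(expfzDr _ _ p0) !(expfzDr _ _ x0).
  by rewrite !(expfzDr _ _ y0) -exprz_inv; ring.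
have tri_e s t : tri (s + 1 + t) + tri (s + 1 - t) = (s * s + s) + t * t.
  by have := tri_double (s + 1 + t); have := tri_double (s + 1 - t); nia.
have tri_o s t : tri (s + t + 1) + tri (s - t) = s * s + (t * t + t).
  by have := tri_double (s + t + 1); have := tri_double (s - t); nia.
have even_sign s : (- 1) ^ (2 * s) = 1 :> F.
  by rewrite -exprz_exp (_ : (-1) ^ 2 = 1) ?exp1rz // -[LHS]/((-1) ^+ 2) sqrrN expr1n.
rewrite /theta_det mulrBr /theta_odd /theta_even; congr (_ + _).
  rewrite mulr_suml mulr_sumr; apply: eq_bigr => s _.
  rewrite !mulr_sumr; apply: eq_bigr => t _; rewrite E tri_e.
  have -> : s + 1 + t + (s + 1 - t) = 2 * (s + 1) by ring.
  have -> : s + 1 + t - (s + 1 - t) = 2 * t by ring.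
  rewrite even_sign; have -> : 2 * (s + 1) = 2 * s + 1 + 1 by ring.
  by rewrite !(expfzDr _ _ x0) !expfzDr // !expr1z; ring.
rewrite mulr_suml mulr_sumr -sumrN; apply: eq_bigr => s _.
rewrite !mulr_sumr -sumrN; apply: eq_bigr => t _; rewrite E tri_o.
have -> : s + t + 1 + (s - t) = 2 * s + 1 by ring.
have -> : s + t + 1 - (s - t) = 2 * t + 1 by ring.
rewrite (expfzDr (2 * s) 1) ?oppr_eq0 ?oner_eq0 // even_sign !expr1z.
by rewrite !expfzDr // !expr1z; ring.
Qed.

(** The Pluecker relation between the 2x2 minors of a 2x4 matrix; u/y is the quotient of the
    prefactors x u and y x. *)
Lemma theta_det_plucker p x y u v N : y != 0 ->
  theta_det p x y N * theta_det p u v N - theta_det p x v N * theta_det p u y N =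
  u / y * (theta_det p y v N * theta_det p x u N).
Proof. by move=> y0; rewrite /theta_det; field. Qed.
End ThetaDeterminant.

(** * Weierstrass addition formula *)

Section ThetaLimits.
Variables (R : realType) (p : R[i]).
Hypotheses (p_neq0 : p != 0) (p_lt1 : `|p| < 1).
Local Notation C := R[i].
Local Notation r := (normc p).

Let r0 : 0 < r. Proof. exact: normc_gt0. Qed.
Let r1 : r < 1. Proof. by move: p_lt1; rewrite normr_normc ltcR. Qed.
Let r0' : 0 <= r. Proof. exact: ltW. Qed.

Let geometric0 (M : R) : ((fun n => M * r ^+ n) @ \oo --> (0 : R))%classic.
Proof. by apply: cvg_geometric; rewrite ger0_norm. Qed.

(** Plus signs match the triple product; the partial products of [theta1 p x] arise at y = -x. *)
Definition theta_partial (y : C) (N : nat) : C :=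
  \prod_(0 <= j < N) ((1 + p ^+ j * y) * (1 + p ^+ j.+1 / y)).

Lemma theta_partial_cauchy y : exists M : R,
  forall n m, (n <= m)%N ->
    normc (theta_partial y m - theta_partial y n) <= M * r ^+ n.
Proof.
(* The j-th factor minus 1. Leaving y / y uncancelled keeps the expansion valid at y = 0. *)
pose e j : C := p ^+ j * y + p ^+ j.+1 / y + p ^+ (j.*2.+1) * (y / y).
have pE N : theta_partial y N = \prod_(0 <= j < N) (1 + e j).
  apply: eq_bigr => j _; rewrite /e -addnn -addSn exprD; ring.
pose c := normc y + normc y^-1 + normc (y / y).
have c0 : 0 <= c by rewrite !addr_ge0 // normc_ge0.
have [j|M [_ _ hM]] := @prod_geometric_cauchy _ e c r c0 r0' r1.
  rewrite /e /c !mulrDl.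
  apply: le_trans (le_normcD _ _) _; rewrite lerD //.
    apply: le_trans (le_normcD _ _) _; rewrite !Normc.normcM normcX mulrC lerD //.
    by rewrite normcX mulrC ler_wpM2l ?normc_ge0 // ler_wiXn2l // ltW.
  rewrite [leLHS]Normc.normcM normcX [leLHS]mulrC ler_wpM2l ?normc_ge0 //.
  by rewrite ler_wiXn2l // ?ltW // -addnn -addSn leq_addl.
by exists M => n m nm; rewrite !pE; exact: hM.
Qed.

(** [theta1] is defined by [lim], which is a genuine limit only once convergence is known. *)
Lemma theta1_cvg x :
  ((theta_partial (- x) : nat -> C^o) @ \oo --> (theta1 p x : C^o))%classic.
Proof.
rewrite /theta1 (_ : (fun N : nat => _) = theta_partial (- x)); last first.
  apply/funext => N; apply: eq_bigr => j _.
  by rewrite mulrN invrN mulrN.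
have [M hM] := theta_partial_cauchy (- x).
exact: cvgC_cauchy hM (geometric0 M).
Qed.

Lemma qfact_neq0 n : qfact p n != 0.
Proof.
rewrite /qfact prodf_seq_neq0; apply/allP => j _ /=.
apply/eqP => /subr0_eq p1.
have : r ^+ j.+1 < 1 by rewrite exprn_ilt1 // ltW.
by rewrite -normcX -p1 Normc.normc1 ltxx.
Qed.

(** With u_n the reciprocal of [qfact p n], the coefficient at k + N is qfact(2N) u_(N+k) u_(N-k).
    Both indices are at least N - |k| and u converges geometrically, so replacing them by N costs
    O(r^(N-|k|)). *)
Lemma qbin_central_estimate : exists M : R, [/\ 0 <= M,
  forall N, normc (qbin p N.*2 N) <= M &
  forall N (k : int), (`|k| <= N)%N ->
    normc (qbin p N.*2 (absz (k + N%:Z)) - qbin p N.*2 N) <= M * r ^+ (N - `|k|)].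
Proof.
have [j|Mq [Mq0 Mq1 _]] := @prod_geometric_cauchy _ (fun j => - p ^+ j.+1) 1 r
  ler01 r0' r1.
  by rewrite normcN normcX mul1r ler_wiXn2l // ltW.
(* Since 1 + t/(1-t) = 1/(1-t), this is the reciprocal of [qfact], in a form to which
   [prod_geometric_cauchy] applies. *)
pose u n : C := \prod_(0 <= j < n) (1 + p ^+ j.+1 / (1 - p ^+ j.+1)).
have d0 j : 1 - p ^+ j.+1 != 0.
  have := qfact_neq0 j.+1; rewrite /qfact big_nat_recr //= mulf_eq0.
  by rewrite negb_or => /andP[].
have uE n : qfact p n * u n = 1.
  rewrite -big_split /= big1 // => j _.
  by have := d0 j; set t := p ^+ _ => t0; field.
have c0 : 0 <= (1 - r)^-1 by rewrite invr_ge0 subr_ge0 ltW.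
have [j|Mu [Mu0 Mu1 Mu2]] := @prod_geometric_cauchy _
   (fun j => p ^+ j.+1 / (1 - p ^+ j.+1)) _ r c0 r0' r1.
  rewrite Normc.normcM Normc.normcV normcX mulrC.
  rewrite ler_pM ?invr_ge0 ?normc_ge0 ?exprn_ge0 //.
    rewrite lef_pV2 ?posrE ?subr_gt0 ?normc_gt0 //.
    apply: (@le_trans _ _ (1 - r ^+ j.+1)).
      by rewrite lerD2l lerN2 -[leRHS]expr1 ler_wiXn2l // ltW.
    rewrite lerBlDr -normcX -{1}(@Normc.normc1 R).
    by apply: le_trans (le_normcD _ _); rewrite subrK.
  by rewrite ler_wiXn2l // ltW.
have qbinE n k : (k <= n)%N -> qbin p n k = qfact p n * u k * u (n - k)%N.
  move=> kn; rewrite -(qbin_fact p kn).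
  have := uE k; have := uE (n - k)%N => h1 h2.
  by rewrite -[LHS]mulr1 -{1}h1 -[LHS]mulr1 -{1}h2; ring.
have udiff n m k : (k <= n)%N -> (k <= m)%N -> normc (u m - u n) <= Mu * r ^+ k.
  wlog nm : n m / (n <= m)%N => [wlg kn km|kn _].
    case/orP: (leq_total n m) => h; first exact: wlg.
    by rewrite -opprB normcN; exact: wlg.
  apply: le_trans (Mu2 _ _ nm) _; rewrite ler_wpM2l //.
  by rewrite ler_wiXn2l // ltW.
have qf1 n : normc (qfact p n) <= Mq by exact: Mq1.
have M0 : 0 <= Mq * (Mu * Mu) by rewrite !mulr_ge0.
exists (2 * (Mq * (Mu * Mu))); split=> [|N|N k kN]; first by rewrite mulr_ge0.
  rewrite qbinE -addnn ?leq_addr // addnK -mulrA !Normc.normcM.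
  apply: (@le_trans _ _ (Mq * (Mu * Mu))); last by lra.
  by rewrite !ler_pM ?mulr_ge0 ?normc_ge0 //; exact: Mu1.
have [aN bN] : (N - `|k| <= absz (k + N%:Z)%R)%N /\
    (N - `|k| <= N.*2 - absz (k + N%:Z)%R)%N.
  by split; lia.
rewrite !qbinE; [|lia|lia].
have -> : (N.*2 - N = N)%N by lia.
set a := absz (k + N%:Z) in aN bN *; set b := (N.*2 - a)%N in bN *.
have -> : qfact p N.*2 * u a * u b - qfact p N.*2 * u N * u N =
  qfact p N.*2 * ((u a - u N) * u b + u N * (u b - u N)) by ring.
rewrite Normc.normcM.
have -> : 2 * (Mq * (Mu * Mu)) * r ^+ (N - `|k|) =
  Mq * (Mu * r ^+ (N - `|k|) * Mu + Mu * (Mu * r ^+ (N - `|k|))) by ring.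
rewrite ler_pM ?normc_ge0 //.
apply: le_trans (le_normcD _ _) _; rewrite !Normc.normcM lerD // ler_pM ?normc_ge0 //.
- by apply: udiff => //; rewrite leq_subr.
- exact: Mu1.
- exact: Mu1.
- by apply: udiff => //; rewrite leq_subr.
Qed.

(** By the finite triple product the difference is a sum of Gaussian terms weighted by O(r^(N-|k|)),
    and r^(N-|k|) <= r^N (r^k + r^(-k)). The powers r^k and r^(-k) move into the arguments of two
    Gaussian sums, which stay bounded. *)
Lemma theta_partial_gsum y : y != 0 ->
  ((fun N => theta_partial y N - qbin p N.*2 N * gsum p y N : C^o) @ \oo
     --> (0 : C^o))%classic.
Proof.
move=> y0; have [M [M0 _ hM]] := qbin_central_estimate.
have t0 : 0 < normc y by exact: normc_gt0.
have [M1 h1] := @gsum_bounded _ r (r * normc y) r0 r1 (mulr_gt0 r0 t0).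
have [M2 h2] := @gsum_bounded _ r (r^-1 * normc y) r0 r1
  (mulr_gt0 (etrans (invr_gt0 _) r0) t0).
apply: (cvgC0_squeeze _ (geometric0 (M * (M1 + M2)))) => N.
rewrite /theta_partial finite_triple_product // /gsum mulr_sumr -sumrB.
apply: le_trans (normc_le_sum _ _ _) _.
apply: (@le_trans _ _ (\sum_(k <- zrange N)
  M * r ^+ N * (gterm r (r * normc y) k + gterm r (r^-1 * normc y) k))).
  rewrite !(big_seq_cond xpredT); apply: ler_sum => k; rewrite andbT mem_zrange => kN.
  rewrite -mulrBl Normc.normcM normc_gterm.
  have -> : gterm r (r * normc y) k = r ^ k * gterm r (normc y) k.
    by rewrite /gterm expfzMl; ring.
  have -> : gterm r (r^-1 * normc y) k = r ^ (- k) * gterm r (normc y) k.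
    by rewrite /gterm expfzMl exprz_inv; ring.
  rewrite -mulrDl [leRHS]mulrA ler_pM ?normc_ge0 ?gterm_ge0 ?normc_ge0 //.
  apply: le_trans (hM _ _ kN) _; rewrite -mulrA ler_wpM2l //.
  rewrite mulrDr; have rn0 : r != 0 by rewrite gt_eqF.
  rewrite [r ^+ N]exprnP -!expfzDr //; case: (leP 0 k) => k0.
    have -> : N%:Z + - k = (N - `|k|)%N by lia.
    by rewrite lerDr exprz_ge0.
  have -> : N%:Z + k = (N - `|k|)%N by lia.
  by rewrite lerDl exprz_ge0.
rewrite -mulr_sumr big_split /= -mulrA [r ^+ N * _]mulrC mulrA ler_wpM2r ?exprn_ge0 //.
by rewrite ler_wpM2l // lerD //; [exact: h1|exact: h2].
Qed.
End ThetaLimits.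

Section Weierstrass.
Variables (R : realType) (p : R[i]).
Hypothesis p_lt1 : `|p| < 1.
Local Notation C := R[i].
Local Notation r := (normc p).

Lemma cvg_eqfun (f g : nat -> C^o) (l : C^o) : f =1 g ->
  (f @ \oo --> l -> g @ \oo --> l)%classic.
Proof. by move=> /funext ->. Qed.

(** The product of the two theta limits involves a sum over [square N], the determinant a sum over
    the rotated window of size N+1. They differ by at most a tail of an absolutely convergent double
    series. *)
Lemma theta_det_cvg x y : p != 0 -> x != 0 -> y != 0 ->
  ((fun N => qbin p N.*2 N ^+ 2 * theta_det p x y N.+1 : C^o) @ \oo
     --> (theta1 p (x * y) * theta1 p (x / y) : C^o))%classic.
Proof.
move=> p0 x0 y0.
have r0 : 0 < r by exact: normc_gt0.
have r1 : r < 1 by move: p_lt1; rewrite normr_normc ltcR.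
pose kap N : C^o := qbin p N.*2 N.
have lim1 w : w != 0 ->
    ((fun N => kap N * gsum p (- w) N : C^o) @ \oo --> (theta1 p w : C^o))%classic.
  move=> w0; have w0' : - w != 0 by rewrite oppr_eq0.
  have h1 := @theta1_cvg _ _ p0 p_lt1 w.
  have h2 := theta_partial_gsum p0 p_lt1 w0'.
  have h := cvgB h1 h2; rewrite subr0 in h.
  refine (@cvg_eqfun _ _ _ _ (h _)); move=> N.
  by rewrite opprB addrC subrK.
pose X := - (x * y); pose Y := - (x / y).
have X0 : X != 0 by rewrite oppr_eq0 mulf_neq0.
have Y0 : Y != 0 by rewrite oppr_eq0 mulf_neq0 ?invr_eq0.
have limX := lim1 _ (mulf_neq0 x0 y0).
have limY := lim1 (x / y) (mulf_neq0 x0 (etrans (congr1 negb (invr_eq0 y)) y0)).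
(* The real majorant of the double series is monotone and convergent; its tail controls the change
   of window. *)
pose H N := gsum r (normc X) N * gsum r (normc Y) N.
have H_cvg : cvgn H.
  by apply: is_cvgM; apply: gsum_cvg => //; exact: normc_gt0.
have H_homo : {homo H : m n / (m <= n)%N >-> m <= n}.
  move=> m n mn; apply: ler_pM; rewrite ?gsum_ge0 ?gsum_homo ?normc_ge0 // ltW //.
have [M [M0 kapM _]] := qbin_central_estimate p0 p_lt1.
have e0 : ((fun N => M ^+ 2 * (limn H - H N)) @ \oo --> (0 : R))%classic.
  rewrite -(mulr0 (M ^+ 2)); apply: cvgMr; rewrite -(subrr (limn H)).
  by apply: cvgB => //; exact: cvg_cst.
have diff0 : ((fun N => kap N ^+ 2 * (theta_det p x y N.+1 -
     gsum p X N * gsum p Y N) : C^o) @ \oo --> (0 : C^o))%classic.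
  apply: (cvgC0_squeeze _ e0) => N.
  rewrite Normc.normcM normcX ler_pM ?exprn_ge0 ?normc_ge0 //.
    by apply: lerXn2r; rewrite ?nnegrE ?normc_ge0 //; exact: kapM.
  rewrite -sum_parity_squares // -sum_square.
  apply: le_trans (normc_sumB_nested _ (square_uniq N) (parity_squares_uniq _)
    (square_uniq _) (@square_sub_parity N) (@parity_sub_square N.+1)) _.
  have HE K : \sum_(c <- square K) normc (gterm p X c.1 * gterm p Y c.2) = H K.
    rewrite /H -sum_square; apply: eq_bigr => c _.
    by rewrite Normc.normcM !normc_gterm.
  by rewrite !HE lerD2r; exact: nondecreasing_cvgn_le.
have h := cvgD (cvgM limX limY) diff0; rewrite addr0 in h.
refine (@cvg_eqfun _ _ _ _ (h _ _)); move=> N.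
transitivity (kap N * gsum p X N * (kap N * gsum p Y N) +
  kap N ^+ 2 * (theta_det p x y N.+1 - gsum p X N * gsum p Y N)) => //.
by rewrite /kap; ring.
Qed.

Lemma theta1_0 (x : C) : theta1 0 x = 1 - x.
Proof.
apply: (@cvg_lim (C^o : normedModType C)); first exact: norm_hausdorff.
(* The product at N = 0 is empty; from N = 1 on the sequence is constant, since 0^0 = 1. *)
rewrite -cvg_shiftS.
rewrite [X in (X @ _)%classic](_ : _ = fun=> (1 - x : C^o)); first exact: cvg_cst.
apply/funext => N /=; rewrite big_nat_recl // expr0 expr1 mul1r mul0r subr0 mulr1.
by rewrite big1 ?mulr1 // => j _; rewrite !expr0n !mul0r !subr0 mulr1.
Qed.

(** The limit of [theta_det_plucker] times the fourth power of the central Gaussian binomial, two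
    powers for each determinant. *)
Lemma weierstrass_addition x y u v : x != 0 -> y != 0 -> u != 0 -> v != 0 ->
  theta1 p (x * y) * theta1 p (x / y) * (theta1 p (u * v) * theta1 p (u / v)) -
  theta1 p (x * v) * theta1 p (x / v) * (theta1 p (u * y) * theta1 p (u / y)) =
  u / y * (theta1 p (y * v) * theta1 p (y / v) *
           (theta1 p (x * u) * theta1 p (x / u))).
Proof.
(* [theta_det_cvg] excludes p = 0, where theta(x) = 1 - x and the identity is rational. *)
move=> x0 y0 u0 v0; have [->|p0] := eqVneq p 0.
  by rewrite !theta1_0; field; rewrite ?x0 ?y0 ?u0 ?v0.
have scale (G : comPzRingType) (k t1 t2 t3 t4 t5 t6 w : G) :
    t1 * t2 - t3 * t4 = w * (t5 * t6) ->
    w * (k ^+ 2 * t5 * (k ^+ 2 * t6)) =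
    k ^+ 2 * t1 * (k ^+ 2 * t2) - k ^+ 2 * t3 * (k ^+ 2 * t4).
  move=> e; transitivity (k ^+ 4 * (w * (t5 * t6))); first by ring.
  by rewrite -e; ring.
pose D a b N : C^o := qbin p N.*2 N ^+ 2 * theta_det p a b N.+1.
have limD a b : a != 0 -> b != 0 ->
    (D a b @ \oo --> (theta1 p (a * b) * theta1 p (a / b) : C^o))%classic.
  by move=> a0 b0; exact: theta_det_cvg.
have lhs := cvgB (cvgM (limD _ _ x0 y0) (limD _ _ u0 v0))
                 (cvgM (limD _ _ x0 v0) (limD _ _ u0 y0)).
have rhs := cvgM (cvg_cst (u / y : C^o)) (cvgM (limD _ _ y0 v0) (limD _ _ x0 u0)).
rewrite -(cvg_lim (@norm_hausdorff _ C^o) (lhs _ _ _)).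
apply: (cvg_lim (@norm_hausdorff _ C^o)).
refine (@cvg_eqfun _ _ _ _ (rhs _ _ _)); move=> N.
transitivity (u / y * (D y v N * D x u N)); first by [].
transitivity (D x y N * D u v N - D x v N * D u y N); last by [].
exact/scale/theta_det_plucker.
Qed.
End Weierstrass.

(** * Elliptic numbers *)

Section EllipticRecursion.
Variables (R : realType) (a b q p lam z : R[i]).
Hypotheses (a_neq0 : a != 0) (b_neq0 : b != 0) (p_lt1 : `|p| < 1).
Hypothesis q_lam : cexp lam = q.
Local Notation C := R[i].

Lemma cexpD (x y : C) : cexp (x + y) = cexp x * cexp y.
Proof.
case: x => x1 x2; case: y => y1 y2; rewrite /cexp /= expRD cosD sinD.
by apply/eqP; rewrite eq_complex /=; apply/andP; split; apply/eqP; ring.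
Qed.

Lemma cexp0 : cexp (0 : C) = 1.
Proof. by rewrite /cexp /= expR0 cos0 sin0 mulr1. Qed.

Lemma cexp_neq0 (x : C) : cexp x != 0.
Proof.
apply/eqP => x0; have := cexpD x (- x); rewrite subrr cexp0 x0 mul0r.
by move/eqP; rewrite oner_eq0.
Qed.

Let q_neq0 : q != 0. Proof. by rewrite -q_lam cexp_neq0. Qed.

Lemma cpow_neq0 (x : C) : cpow lam x != 0.
Proof. exact: cexp_neq0. Qed.

Lemma cpow_intD (x : C) (k : int) : cpow lam (x + k%:~R) = cpow lam x * q ^ k.
Proof.
rewrite /cpow mulrDr cexpD; congr (_ * _).
have expn (n : nat) : cexp (lam * n%:R) = q ^+ n.
  elim: n => [|n IH]; first by rewrite mulr0 cexp0.
  by rewrite mulrS mulrDr mulr1 cexpD q_lam IH exprS.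
case: k => n; first exact: expn.
rewrite NegzE mulrNz mulrN -exprnN -expn.
apply: (mulIf (cexp_neq0 (lam * n.+1%:R))).
by rewrite -cexpD addNr cexp0 mulVf ?cexp_neq0.
Qed.

(** The recursion for E_s with denominators cleared, at A = a q^(2s), B = b q^s, X = q^(z-s). A
    square root of A makes AX and X, as well as Aq and q, the product and quotient of two
    arguments. *)
Lemma elliptic_theta_identity (A B X : C) : A != 0 -> B != 0 -> X != 0 ->
  theta1 p X * theta1 p (A * X) * (theta1 p (B * q ^+ 2) * theta1 p (A / B)) =
  theta1 p q * theta1 p (A * q) *
    (theta1 p (B * q * X) * theta1 p (A * X / (B * q))) +
  q * (theta1 p (B * q) * theta1 p (A / (B * q)) *
       (theta1 p (X / q) * theta1 p (A * q * X))).
Proof.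
move=> A0 B0 X0; pose y := sqrtC A.
have yA : A = y * y by rewrite -expr2 sqrtCK.
have y0 : y != 0 by rewrite sqrtC_eq0.
(* Here [xy = AX], [x/y = X], [uv = Bq^2] and [u/v = A/B]. *)
have := @weierstrass_addition _ p p_lt1 (y * X) y (y * q) (B * q / y).
rewrite !mulf_neq0 ?invr_eq0 // => /(_ isT y0 isT isT).
have -> : y * X * y = A * X by rewrite yA; ring.
have -> : y * X / y = X by field.
have -> : y * q * (B * q / y) = B * q ^+ 2 by field.
have -> : y * q / (B * q / y) = A / B by rewrite yA; field; rewrite ?y0 ?B0 ?q_neq0.
have -> : y * X * (B * q / y) = B * q * X by field.
have -> : y * X / (B * q / y) = A * X / (B * q).
  by rewrite yA; field; rewrite ?y0 ?B0 ?q_neq0.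
have -> : y * q * y = A * q by rewrite yA; ring.
have -> : y * q / y = q by field.
have -> : y * (B * q / y) = B * q by field.
have -> : y / (B * q / y) = A / (B * q) by rewrite yA; field; rewrite ?y0 ?B0 ?q_neq0.
have -> : y * X * (y * q) = A * q * X by rewrite yA; ring.
have -> : y * X / (y * q) = X / q by field; rewrite ?y0 ?q_neq0.
move=> /eqP; rewrite subr_eq => /eqP E.
transitivity (theta1 p (A * X) * theta1 p X *
  (theta1 p (B * q ^+ 2) * theta1 p (A / B))); first by ring.
by rewrite E; ring.
Qed.

(** The E_s of the recursion. Both sides of the theorem consist of such factors: s = j-1 on the left
    and s = i-1-b_i on the right. *)
Definition elliptic_factor (s : int) : C :=
  shifted_elliptic_number lam a b q p s (z - s%:~R).

(** Of the four factors only theta(a q^(2s+1)) depends on s, so nonvanishing of the other three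
    carries over from one s to all. *)
Lemma shifted_elliptic_denE (s : int) :
  shifted_elliptic_den lam a b q p s (z - s%:~R) =
  theta1 p q * theta1 p (a * q ^ (2 * s + 1)) *
  (theta1 p (b * q * cpow lam z) * theta1 p (a * cpow lam z / (b * q))).
Proof.
rewrite /shifted_elliptic_den /elliptic_den /theta !big_cons big_nil mulr1.
rewrite -[RHS]mulrA.
have qs : q ^ s != 0 by rewrite expfz_neq0.
have -> : z - s%:~R + 1 = z + (1 - s)%:~R by rewrite intrB; ring.
have -> : z - s%:~R - 1 = z + (- 1 - s)%:~R by rewrite intrB mulrNz; ring.
have q2s : q ^ (2 * s) = q ^ s * q ^ s by rewrite -expfzDr //; congr (_ ^ _); ring.
rewrite !cpow_intD; set X := cpow lam z.
congr (_ * (theta1 p _ * (theta1 p _ * theta1 p _))).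
- by rewrite expfzDr // expr1z mulrA.
- by rewrite expfzDr // -invr_expz expr1z; field; rewrite ?qs ?q_neq0.
- by rewrite expfzDr // -!invr_expz expr1z q2s; field; rewrite ?qs ?b_neq0 ?q_neq0.
Qed.

Lemma elliptic_factor_rec (s : int) :
  theta1 p q != 0 -> theta1 p (b * q * cpow lam z) != 0 ->
  theta1 p (a * cpow lam z / (b * q)) != 0 ->
  theta1 p (a * q ^ (2 * s + 1)) != 0 ->
  theta1 p (a * q ^ (2 * (s + 1) + 1)) != 0 ->
  weight_den a b q p (s + 1) != 0 ->
  elliptic_factor s = 1 + weight a b q p (s + 1) * elliptic_factor (s + 1).
Proof.
rewrite /elliptic_factor /shifted_elliptic_number /elliptic_number.
rewrite -!/(shifted_elliptic_den _ _ _ _ _ _ _) !shifted_elliptic_denE.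
rewrite /elliptic_num /weight /weight_num /weight_den /theta !big_cons !big_nil !mulr1.
have -> : z - s%:~R = z + (- s)%:~R by rewrite mulrNz.
have -> : z - (s + 1)%:~R = z + (- (s + 1))%:~R by rewrite mulrNz.
rewrite !cpow_intD; move: (cpow lam z) (cpow_neq0 z) => Z Z0.
have qs : q ^ s != 0 by rewrite expfz_neq0.
pose A := a * q ^ (2 * s); pose B := b * q ^ s; pose X := Z / q ^ s.
have A0 : A != 0 by rewrite mulf_neq0 ?expfz_neq0.
have B0 : B != 0 by rewrite mulf_neq0.
have X0 : X != 0 by rewrite mulf_neq0 ?invr_eq0.
have qss : q ^ (2 * s) = q ^ s * q ^ s by rewrite -expfzDr //; congr (_ ^ _); ring.
have qs1 : q ^ (s + 1) = q ^ s * q by rewrite expfzDr // expr1z.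
have qss1 : q ^ (2 * (s + 1)) = q ^ (2 * s) * q ^+ 2.
  by rewrite exprnP -expfzDr //; congr (_ ^ _); ring.
have nz := (qs, b_neq0, q_neq0).
have -> : b * q * Z = B * q * X by rewrite /B /X; field; rewrite ?nz.
have -> : a * Z / (b * q) = A * X / (B * q).
  by rewrite /A /B /X qss; field; rewrite ?nz.
have -> : q ^ (- s) = (q ^ s)^-1 by rewrite invr_expz.
have -> : q ^ (- (s + 1)) = (q ^ s * q)^-1 by rewrite -invr_expz qs1.
have -> : a * q ^ (2 * s) * (Z / q ^ s) = A * X by [].
have -> : a * q ^ (2 * (s + 1)) * (Z / (q ^ s * q)) = A * q * X.
  by rewrite qss1 /A /X; field; rewrite ?nz.
have -> : a * q ^ (2 * (s + 1)) / (b * q ^ (s + 1)) = A * q / B.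
  by rewrite qss1 qs1 /A /B; field; rewrite ?nz.
have -> : a * q ^ (2 * s) / (b * q ^ s) = A / B by [].
have -> : b * q ^ (s + 1) * q ^+ 2 = B * q ^+ 3.
  by rewrite qs1 /B; ring.
have -> : b * q ^ (s + 1) = B * q by rewrite qs1 mulrA.
have -> : b * q ^ (s + 1 + 2) = B * q ^+ 3.
  by rewrite /B -mulrA exprnP -expfzDr //; congr (_ * _ ^ _); ring.
have -> : a * q ^ (s + 1 - 2) / b = A / (B * q).
  have -> : s + 1 - 2 = s + (-1) by ring.
  by rewrite expfzDr // exprN1 /A /B qss; field; rewrite ?nz.
have -> : a * q ^ (s + 1) / b = A * q / B.
  by rewrite qs1 /A /B qss; field; rewrite ?nz.
have -> : 2 * (s + 1) - 1 = 2 * s + 1 by ring.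
have -> : a * q ^ (2 * s + 1) = A * q by rewrite expfzDr // expr1z mulrA.
have -> : Z / (q ^ s * q) = X / q by rewrite /X; field; rewrite ?nz.
have := elliptic_theta_identity A0 B0 X0.
rewrite -!/B -!/A -!/X.
(* Theta values become opaque atoms, so that only rational algebra remains. *)
move: (theta1 p (B * q ^+ 3)) (theta1 p (a * q ^ (2 * (s + 1) + 1))) => t1 t2.
move: (theta1 p q) (theta1 p X) (theta1 p (A * X)) (theta1 p (B * q ^+ 2))
  (theta1 p (A / B)) (theta1 p (A * q)) (theta1 p (B * q * X))
  (theta1 p (A * X / (B * q))) (theta1 p (B * q)) (theta1 p (A / (B * q)))
  (theta1 p (X / q)) (theta1 p (A * q * X)) (theta1 p (A * q / B)).
move=> u1 u2 u3 u4 u5 u6 u7 u8 u9 u10 u11 u12 u13 E n1 n7 n8 n6 n2.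
rewrite !mulf_eq0 !negb_or => /and3P[_ m1 m13].
have -> : u2 * (u3 * (u4 * u5)) = u2 * u3 * (u4 * u5) by ring.
by rewrite E; field; rewrite ?n1 ?n7 ?n8 ?n6 ?n2 ?m1 ?m13.
Qed.
End EllipticRecursion.

(** * Rook placements *)

Section Placements.
Local Open Scope fset_scope.

(** All sizes together, so that adding a column need not track the number of rooks. *)
Definition nonattacking_placements (B : {fset cell}) : {fset {fset cell}} :=
  [fset P in fpowerset B | nonattacking P].

Definition occupied_rows (P : {fset cell}) : seq nat := [seq d.2 | d <- P].

Lemma mem_ferrers n h (c : cell) :
  (c \in ferrers n h) = (0 < c.1 <= n)%N && (0 < c.2 <= h c.1)%N.
Proof.
case: c => i j; rewrite in_fset /=; apply/allpairsPdep/idP => /=.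
  by case=> i' [j' [+ + [-> ->]]]; rewrite !mem_iota; lia.
by move=> H; exists i, j; rewrite !mem_iota; split => //; lia.
Qed.

Lemma nonattackingP (P : {fset cell}) :
  reflect {in P &, forall c d, c != d -> (c.1 != d.1) && (c.2 != d.2)}
          (nonattacking P).
Proof.
apply: (iffP forallP) => [H c d cP dP cd|H c].
  by have /forallP /(_ [` dP]) := H [` cP]; rewrite -val_eqE /= cd.
apply/forallP => d; apply/implyP; rewrite -val_eqE => cd.
exact: H (valP c) (valP d) cd.
Qed.

Lemma mem_nonattacking_placements (B P : {fset cell}) :
  (P \in nonattacking_placements B) = (P `<=` B) && nonattacking P.
Proof. by rewrite !inE fpowersetE. Qed.

Lemma mem_placements k (B P : {fset cell}) :
  (P \in placements k B) = (P \in nonattacking_placements B) && (#|` P| == k).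
Proof. by rewrite mem_nonattacking_placements !inE fpowersetE andbA. Qed.

Lemma mem_uncancelled (B P : {fset cell}) c :
  (c \in uncancelled B P) =
  [&& c \in B, c \notin P & ~~ has (fun d => cancels d c) P].
Proof.
rewrite !inE; congr [&& _, _ & ~~ _]; apply/existsP/hasP => [[d dc]|[d dP dc]].
  by exists (val d) => //; exact: valP.
by exists [` dP].
Qed.

Lemma fsetU1_perm (K : choiceType) (x : K) (P : {fset K}) :
  x \notin P -> perm_eq (x |` P) (x :: P).
Proof.
move=> xP; apply: uniq_perm; rewrite ?fset_uniq //= ?xP ?fset_uniq // => y.
by rewrite in_fset1U in_cons.
Qed.

Lemma rooks_nwE (P : {fset cell}) c :
  rooks_nw P c = count (fun d : cell => (d.1 < c.1)%N && (c.2 < d.2)%N) P.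
Proof.
rewrite /rooks_nw -size_filter; apply: perm_size; apply: uniq_perm.
- exact: fset_uniq.
- exact: filter_uniq (fset_uniq _).
- by move=> d; rewrite !inE mem_filter andbC.
Qed.

Lemma nonattacking_sub (P Q : {fset cell}) :
  P `<=` Q -> nonattacking Q -> nonattacking P.
Proof.
move=> /fsubsetP PQ /nonattackingP H; apply/nonattackingP => c d /PQ cQ /PQ dQ.
exact: H.
Qed.

(** Serves both projections: rooks have distinct columns and distinct rows. *)
Lemma nonattacking_map_uniq (P : {fset cell}) (f : cell -> nat) :
  (forall c d, f c = f d -> (c.1 != d.1) && (c.2 != d.2) = false) ->
  nonattacking P -> uniq [seq f c | c <- P].
Proof.
move=> fE /nonattackingP H; rewrite map_inj_in_uniq ?fset_uniq // => c d cP dP fcd.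
by apply/eqP; apply: contraFT (fE _ _ fcd); exact: H.
Qed.

(** * Adding a last column to the board *)

Section LastColumn.
Variables (n : nat) (h : nat -> nat).
Local Notation B := (ferrers n h).
Local Notation B' := (ferrers n.+1 h).
Local Notation height := (h n.+1).

(** For [P] in the first n columns, these are the cells of the new column that [P] does not
    cancel. *)
Definition free_rows (P : {fset cell}) : seq nat :=
  [seq j <- iota 1 height | j \notin occupied_rows P].

Lemma placement_col (P : {fset cell}) d :
  P \in nonattacking_placements B -> d \in P -> (0 < d.1 <= n)%N.
Proof.
rewrite mem_nonattacking_placements => /andP[/fsubsetP PB _] /PB.
by rewrite mem_ferrers => /andP[].
Qed.

Lemma last_col_notin (P : {fset cell}) j :
  P \in nonattacking_placements B -> (n.+1, j) \notin P.
Proof. by move=> PB; apply/negP => /(placement_col PB) /=; rewrite ltnn. Qed.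

Lemma ferrers_sub : B `<=` B'.
Proof. by apply/fsubsetP => c; rewrite !mem_ferrers; lia. Qed.

Lemma placement_widen (P : {fset cell}) :
  P \in nonattacking_placements B -> P \in nonattacking_placements B'.
Proof.
rewrite !mem_nonattacking_placements => /andP[PB ->].
by rewrite (fsubset_trans PB ferrers_sub).
Qed.

Lemma placement_add (P : {fset cell}) j :
  P \in nonattacking_placements B -> j \in free_rows P ->
  (n.+1, j) |` P \in nonattacking_placements B'.
Proof.
move=> PB; rewrite mem_filter mem_iota => /andP[jP jh].
have := placement_widen PB; rewrite !mem_nonattacking_placements => /andP[PB' Pna].
apply/andP; split.
  apply/fsubsetP => c; rewrite in_fset1U => /orP[/eqP ->|/(fsubsetP PB') //].
  by rewrite mem_ferrers /=; lia.
have new d : d \in P -> (n.+1 != d.1) && (j != d.2).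
  move=> dP; have /= := placement_col PB dP.
  have : j != d.2 by apply: contraNneq jP => ->; exact: map_f.
  by move=> -> /andP[_ dn]; rewrite andbT gtn_eqF.
apply/nonattackingP => c d; rewrite !in_fset1U.
move=> /orP[/eqP ->|cP] /orP[/eqP ->|dP]; rewrite ?eqxx //.
- by move=> _; exact: new.
- by move=> _; rewrite eq_sym [c.2 == _]eq_sym; exact: new.
- by move/nonattackingP: Pna; apply.
Qed.

(** The last column holds no rook, or exactly one, in a free row; deleting that rook inverts the
    second construction. *)
Lemma nonattacking_placementsS :
  perm_eq (nonattacking_placements B')
    (nonattacking_placements B ++
     [seq (n.+1, j) |` P | P <- nonattacking_placements B, j <- free_rows P]).
Proof.
apply: uniq_perm; first exact: fset_uniq.
  rewrite cat_uniq fset_uniq /=; apply/andP; split.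
    apply/hasP => -[Q] /allpairsPdep[P [j [PB jP ->]]] QB.
    have := @last_col_notin _ j QB; apply/negP; rewrite negbK.
    exact: fset1U1.
  apply: allpairs_uniq_dep; first exact: fset_uniq.
    by move=> P _; rewrite filter_uniq // iota_uniq.
  move=> [P j] [P' j'] /allpairsPdep[x [y [xB _ [-> ->]]]].
  move=> /allpairsPdep[x' [y' [xB' _ [-> ->]]]] /= E.
  have yy : y = y'.
    have := fset1U1 (n.+1, y) x; rewrite E in_fset1U => /orP[/eqP[]//|].
    by rewrite (negPf (last_col_notin _ xB')).
  rewrite -yy in E *; congr (existT _ _ _).
  apply/fsetP => c; move/fsetP: E => /(_ c); rewrite !in_fset1U.
  case: eqP => [-> _|//].
  by rewrite (negPf (last_col_notin _ xB)) (negPf (last_col_notin _ xB')).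
move=> Q; rewrite mem_cat; apply/idP/orP; last first.
  case; first exact: placement_widen.
  by case/allpairsPdep => P [j [PB jP ->]]; exact: placement_add.
rewrite !mem_nonattacking_placements => /andP[QB' Qna].
case: (boolP (has (fun c : cell => c.1 == n.+1) Q)) => [/hasP[[i j] cQ /= /eqP iE]|noc].
  right; subst i; apply/allpairsPdep; exists (Q `\ (n.+1, j)), j.
  have na := nonattackingP _ Qna.
  split; last by rewrite fsetD1K.
    rewrite mem_nonattacking_placements.
    rewrite (nonattacking_sub _ Qna) ?fsubD1set // andbT.
    apply/fsubsetP => c; rewrite in_fsetD1 => /andP[cn cQ'].
    have /andP[c1 _] := na _ _ cQ' cQ cn.
    have := fsubsetP QB' _ cQ'; rewrite !mem_ferrers; move: c1 => /=; lia.
  rewrite mem_filter mem_iota; apply/andP; split.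
    apply/mapP => -[d]; rewrite in_fsetD1 => /andP[dn dQ] /= jd.
    by have := na _ _ dQ cQ dn; rewrite /= jd eqxx andbF.
  by have := fsubsetP QB' _ cQ; rewrite mem_ferrers /=; lia.
left; rewrite Qna andbT; apply/fsubsetP => c cQ.
have := fsubsetP QB' _ cQ; rewrite !mem_ferrers.
by move/hasPn/(_ _ cQ): noc => /=; lia.
Qed.

Lemma uncancelled_col (P : {fset cell}) (c : cell) :
  c \in uncancelled B P -> (c.1 <= n)%N.
Proof. by rewrite mem_uncancelled mem_ferrers => /andP[/andP[/andP[]]]. Qed.

Lemma uncancelled_widen (P : {fset cell}) : P \in nonattacking_placements B ->
  perm_eq (uncancelled B' P)
    (uncancelled B P ++ [seq (n.+1, j) | j <- free_rows P]).
Proof.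
move=> PB; apply: uniq_perm; first exact: fset_uniq.
  rewrite cat_uniq fset_uniq map_inj_uniq ?filter_uniq ?iota_uniq //;
    last by move=> ? ? [].
  rewrite andbT; apply/hasP => -[c] /mapP[j _ ->] /uncancelled_col.
  by rewrite ltnn.
move=> [i j]; rewrite mem_cat !mem_uncancelled !mem_ferrers /=.
case: (eqVneq i n.+1) => [->|ni]; last first.
  rewrite (_ : _ \in [seq _ | _ <- _] = false) ?orbF.
    by congr (_ && _); lia.
  by apply/mapP => -[? _ []] /eqP; rewrite (negPf ni).
rewrite (mem_map (f := fun j => (n.+1, j))); last by move=> ? ? [].
rewrite mem_filter mem_iota last_col_notin // ltnn andbF /= andbC.
rewrite leqnn /= add1n ltnS; congr (~~ _ && _).
apply/hasP/mapP => -[d dP dc]; exists d => //; move: dc (placement_col PB dP).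
  by rewrite /cancels /=; lia.
by move=> -> ; rewrite /cancels /= eqxx ltnS => /andP[_ ->].
Qed.

(** A rook in the last column has no cell to its right, so it only removes its own cell and the
    cells below it. *)
Lemma uncancelled_add (P : {fset cell}) j0 : P \in nonattacking_placements B ->
  j0 \in free_rows P ->
  perm_eq (uncancelled B' ((n.+1, j0) |` P))
    (uncancelled B P ++ [seq (n.+1, j) | j <- free_rows P & (j0 < j)%N]).
Proof.
move=> PB j0P; apply: uniq_perm; first exact: fset_uniq.
  rewrite cat_uniq fset_uniq map_inj_uniq ?filter_uniq ?iota_uniq //;
    last by move=> ? ? [].
  rewrite andbT; apply/hasP => -[c] /mapP[j _ ->] /uncancelled_col.
  by rewrite ltnn.
move=> [i j]; set x := (n.+1, j0).
have -> : ((i, j) \in uncancelled B' (x |` P)) =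
    [&& (i, j) \in uncancelled B' P, (i, j) != x & ~~ cancels x (i, j)].
  rewrite !mem_uncancelled (perm_has _ (fsetU1_perm (last_col_notin j0 PB))).
  rewrite in_fset1U -[has _ (x :: P)]/(cancels x (i, j) || has _ P).
  move: ((i, j) \in B') ((i, j) == x) ((i, j) \in P) (cancels x (i, j)) (has _ P).
  by do 5!case.
rewrite (perm_mem (uncancelled_widen PB)) !mem_cat xpair_eqE /cancels /x /=.
case: (eqVneq i n.+1) => [->|ni]; last first.
  have notin (s : seq nat) : ((i, j) \in [seq (n.+1, j') | j' <- s]) = false.
    by apply/mapP => -[? _ [E]]; rewrite E eqxx in ni.
  rewrite !notin !orbF; case: (boolP (_ \in _)) => // /uncancelled_col /= iN.
  by lia.
have -> : ((n.+1, j) \in uncancelled B P) = false.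
  by apply/negP => /uncancelled_col; rewrite ltnn.
have inj : injective (fun j : nat => (n.+1, j)) by move=> ? ? [].
rewrite !(mem_map inj) [RHS]mem_filter ltnn andbF /=.
case: (j \in free_rows P) => /=; last by rewrite andbF.
by rewrite andbT; lia.
Qed.
End LastColumn.
End Placements.

(** * The telescoping sum of one column *)

Section ColumnTelescope.
Variables (F : comPzRingType) (height : nat) (free : pred nat) (W E : nat -> F).

Definition free_above (t : nat) : nat := count free (iota t.+1 (height - t)).

Lemma free_above_pred t : (t < height)%N ->
  free_above t = (free t.+1 + free_above t.+1)%N.
Proof. by move=> th; rewrite /free_above -(subnSK th). Qed.

(** At the top of the column the left side is E 0. Passing down a free row splits off W t from the
    product and adds one term to the sum, and 1 + W t E(f+1) = E(f) restores the previous value;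
    other rows change nothing. *)
Lemma column_telescope t :
  (forall t, (0 < t <= height)%N -> free t ->
     E (free_above t) = 1 + W t * E (free_above t).+1) ->
  (t <= height)%N ->
  (\prod_(t.+1 <= j < height.+1 | free j) W j) * E (free_above t) +
  \sum_(t.+1 <= i < height.+1 | free i)
     \prod_(i.+1 <= j < height.+1 | free j) W j = E 0.
Proof.
move=> rec th; rewrite -(subKn th); move: (height - t)%N (leq_subr t height) => d.
elim: d => [|d IH] dh.
  by rewrite subn0 !big_geq // mul1r addr0 /free_above subnn.
set u := (height - d.+1)%N; have uh : (u < height)%N by rewrite /u; lia.
have {}IH := IH (ltnW dh); have uE : (height - d = u.+1)%N by rewrite /u; lia.
rewrite uE in IH; rewrite -{}IH free_above_pred //.
rewrite ![\big[_/_]_(u.+1 <= _ < _ | _) _]big_ltn_cond ?ltnS //.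
case: ifP => fu; last by rewrite add0n.
by rewrite [in RHS](rec u.+1) // add1n; ring.
Qed.

(** The count changes only at free rows, so each of its values is taken at 0 or at a free row. *)
Lemma free_above_ind (Q : nat -> Prop) :
  Q (free_above 0) ->
  (forall t, (0 < t <= height)%N -> free t -> Q (free_above t)) ->
  forall t, (t <= height)%N -> Q (free_above t).
Proof.
move=> Q0 Qf; elim=> // t IH th; case: (boolP (free t.+1)) => fr; first exact: Qf.
by have := IH (ltnW th); rewrite free_above_pred // (negPf fr).
Qed.
End ColumnTelescope.

Lemma iota1E m : iota 1 m = index_iota 1 m.+1.
Proof. by rewrite /index_iota subn1. Qed.

(** * Rook sums, column by column *)

Section RookSums.
Local Open Scope fset_scope.
Local Open Scope ring_scope.
Variables (F : comPzRingType) (w : int -> F) (h : nat -> nat).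

Definition rook_weight (B P : {fset cell}) : F :=
  \prod_(c <- uncancelled B P) w (weight_arg P c).

Definition column_weight (n : nat) (P : {fset cell}) (j : nat) : F :=
  w (weight_arg P (n.+1, j)).

Lemma card_placement n (P : {fset cell}) :
  P \in nonattacking_placements (ferrers n h) -> (#|` P| <= n)%N.
Proof.
move=> PB; rewrite -(size_iota 1 n) -(size_map (fun c : cell => c.1)).
apply: uniq_leq_size.
  apply: nonattacking_map_uniq => [c d ->|]; first by rewrite eqxx.
  by move: PB; rewrite mem_nonattacking_placements => /andP[].
by move=> i /mapP[c cP ->]; rewrite mem_iota add1n ltnS; exact: placement_col PB cP.
Qed.

Lemma weight_arg_add n (P : {fset cell}) j c :
  P \in nonattacking_placements (ferrers n h) -> (c.1 <= n.+1)%N ->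
  weight_arg ((n.+1, j) |` P) c = weight_arg P c.
Proof.
move=> PB cn; rewrite /weight_arg !rooks_nwE.
rewrite (permP (fsetU1_perm (last_col_notin j PB))) /=.
by rewrite ltnNge cn.
Qed.

Lemma rook_weight_widen n (P : {fset cell}) :
  P \in nonattacking_placements (ferrers n h) ->
  rook_weight (ferrers n.+1 h) P = rook_weight (ferrers n h) P *
    \prod_(1 <= j < (h n.+1).+1 | j \notin occupied_rows P) column_weight n P j.
Proof.
move=> PB; rewrite /rook_weight (perm_big _ (uncancelled_widen PB)) big_cat /=.
by rewrite big_map big_filter iota1E.
Qed.

Lemma rook_weight_add n (P : {fset cell}) i :
  P \in nonattacking_placements (ferrers n h) -> i \in free_rows n h P ->
  rook_weight (ferrers n.+1 h) ((n.+1, i) |` P) = rook_weight (ferrers n h) P *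
    \prod_(i.+1 <= j < (h n.+1).+1 | j \notin occupied_rows P) column_weight n P j.
Proof.
move=> PB iP; rewrite /rook_weight (perm_big _ (uncancelled_add PB iP)) big_cat /=.
congr (_ * _).
  rewrite !big_seq; apply: eq_bigr => c /uncancelled_col cn.
  by rewrite weight_arg_add // leqW.
rewrite big_map big_filter big_filter_cond.
under eq_bigr => j _ do rewrite weight_arg_add //.
move: iP; rewrite mem_filter mem_iota => /andP[_ iP].
rewrite iota1E (big_cat_nat (n := i.+1)) //=; last by lia.
rewrite [X in X * _]big_nat_cond big_pred0 ?mul1r; last by move=> j; lia.
rewrite big_nat_cond [RHS]big_nat_cond; apply: eq_bigl => j.
by case: (j \in occupied_rows P) => /=; lia.
Qed.

(** Each row above t in the new column is free or holds exactly one rook of [P]. Monotone heights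
    ensure that no rook of [P] lies above the top of that column. *)
Lemma rooks_above n (P : {fset cell}) t :
  (forall i, (1 <= i <= n)%N -> (h i <= h n.+1)%N) ->
  P \in nonattacking_placements (ferrers n h) -> (t <= h n.+1)%N ->
  (count (fun d : cell => t < d.2) P +
     free_above (h n.+1) [pred j | j \notin occupied_rows P] t = h n.+1 - t)%N.
Proof.
move=> hmono PB th; have := PB.
rewrite mem_nonattacking_placements => /andP[/fsubsetP Psub Pna].
have -> : count (fun d : cell => (t < d.2)%N) P =
    count (mem (occupied_rows P)) (iota t.+1 (h n.+1 - t)).
  rewrite -[LHS](count_map (fun d : cell => d.2) (fun j => t < j)%N) -!size_filter.
  apply: perm_size; apply: uniq_perm; rewrite ?filter_uniq ?iota_uniq //.
    by apply: nonattacking_map_uniq Pna => c d ->; rewrite eqxx andbF.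
  move=> j; rewrite !mem_filter mem_iota /= -/(occupied_rows P).
  case: (boolP (j \in occupied_rows P)) => [/mapP[d dP ->]|]; last by rewrite andbF.
  have := Psub _ dP; rewrite mem_ferrers => /andP[/hmono hd /andP[_ hd']].
  by rewrite andbT addSn subnKC // ltnS (leq_trans hd' hd) andbT.
by rewrite /free_above -[RHS](size_iota t.+1) -(count_predC (mem (occupied_rows P))).
Qed.

(** The rooks northwest of the cell number h(n+1) - t minus the free rows above it, so t cancels:
    the argument depends on [P] and t only through that count of free rows. *)
Lemma column_weight_arg n (P : {fset cell}) t :
  (forall i, (1 <= i <= n)%N -> (h i <= h n.+1)%N) ->
  P \in nonattacking_placements (ferrers n h) -> (t <= h n.+1)%N ->
  weight_arg P (n.+1, t) = n%:Z - (h n.+1)%:Z +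
    (free_above (h n.+1) [pred j | j \notin occupied_rows P] t)%:Z + 1.
Proof.
move=> hmono PB th; rewrite /weight_arg rooks_nwE /=.
rewrite (_ : count _ _ = count (fun d : cell => t < d.2)%N P); last first.
  by apply: eq_in_count => d /(placement_col PB) /andP[_ dn]; rewrite ltnS dn.
have := rooks_above hmono PB th; set f := free_above _ _ _; set c := count _ _.
by move: f c => f c; lia.
Qed.

Variables S T : nat -> F.

Definition rook_sum (n : nat) : F :=
  \sum_(P <- nonattacking_placements (ferrers n h))
    rook_weight (ferrers n h) P * \prod_(1 <= j < (n - #|` P|).+1) S j.

(** Each [P] extends without a new rook, which brings one more factor [S], or with a rook in a free
    row, which keeps n - #P. The hypothesis says that these extensions together multiply the term of
    [P] by T(n+1). *)
Lemma rook_sumS n :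
  (forall P, P \in nonattacking_placements (ferrers n h) ->
    (\prod_(1 <= j < (h n.+1).+1 | j \notin occupied_rows P) column_weight n P j) *
      S (n - #|` P|).+1 +
    \sum_(1 <= i < (h n.+1).+1 | i \notin occupied_rows P)
      \prod_(i.+1 <= j < (h n.+1).+1 | j \notin occupied_rows P)
        column_weight n P j = T n.+1) ->
  rook_sum n.+1 = rook_sum n * T n.+1.
Proof.
move=> step; rewrite /rook_sum (perm_big _ (nonattacking_placementsS n h)) big_cat.
rewrite big_allpairs_dep /= -big_split mulr_suml /=.
rewrite !big_seq; apply: eq_bigr => P PB.
have Pn := card_placement PB.
rewrite rook_weight_widen // subSn // big_nat_recr //=.
rewrite [X in _ + X]big_seq [X in _ + X](eq_bigr (fun i => rook_weight (ferrers n h) P *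
  (\prod_(1 <= j < (n - #|` P|).+1) S j) *
  \prod_(i.+1 <= j < (h n.+1).+1 | j \notin occupied_rows P) column_weight n P j));
  last first.
  move=> i iP; rewrite rook_weight_add // cardfsU1 (last_col_notin i PB) add1n subSS.
  by ring.
rewrite -[X in _ + X]big_seq -mulr_sumr big_filter -(step _ PB).
by rewrite iota1E; ring.
Qed.

Lemma rook_sum0 : rook_sum 0 = 1.
Proof.
have B0 c : c \in ferrers 0 h = false by rewrite mem_ferrers; lia.
have BE : ferrers 0 h = fset0 by apply/fsetP => c; rewrite B0.
rewrite /rook_sum (_ : nonattacking_placements _ = [fset fset0]); last first.
  apply/fsetP => P; rewrite mem_nonattacking_placements BE fsubset0 in_fset1.
  by case: eqP => // ->; apply/nonattackingP => c.
rewrite big_seq_fset1 cardfs0 big_geq // mulr1 /rook_weight.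
rewrite big_seq big_pred0 // => c.
by rewrite mem_uncancelled B0.
Qed.
End RookSums.

(** Exchanging the sums, each placement [P] meets only k = n - #P. *)
Lemma elliptic_rook_sum (R : realType) (a b q p : R[i]) n h (S : nat -> R[i]) :
  \sum_(0 <= k < n.+1) elliptic_rook a b q p (n - k) (ferrers n h) *
     \prod_(1 <= j < k.+1) S j =
  rook_sum (weight a b q p) h S n.
Proof.
pose NA := nonattacking_placements (ferrers n h).
have E k : elliptic_rook a b q p (n - k) (ferrers n h) *
   \prod_(1 <= j < k.+1) S j =
   \sum_(P <- NA | #|` P|%fset == (n - k)%N)
     rook_weight (weight a b q p) (ferrers n h) P * \prod_(1 <= j < k.+1) S j.
  rewrite mulr_suml -[RHS]big_filter; apply: perm_big; apply: uniq_perm.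
  - exact: fset_uniq.
  - exact: filter_uniq (fset_uniq _).
  - by move=> P; rewrite mem_placements mem_filter andbC.
rewrite big_mkord; under eq_bigr => k _ do rewrite E.
rewrite (exchange_big_dep xpredT) //= /rook_sum !big_seq; apply: eq_bigr => P PB.
have Pn := card_placement PB.
have kn : (n - #|` P|%fset < n.+1)%N by rewrite ltnS leq_subr.
rewrite (big_pred1 (Ordinal kn)) //= => k.
apply/eqP/eqP => [PE|-> /=]; last by rewrite subKn.
by apply: val_inj; rewrite /= PE subKn // -ltnS.
Qed.

(** * The product formula for elliptic rook numbers *)

Unset Implicit Arguments.
Theorem theorem3p8 (R : realType) (n : nat) (h : nat -> nat)
    (a b q p lam z : R[i])
    (h_mono : forall i j : nat,
       (1 <= i)%N -> (i <= j)%N -> (j <= n)%N -> (h i <= h j)%N)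
    (a_neq0 : a != 0) (b_neq0 : b != 0) (q_neq0 : q != 0)
    (p_lt1 : `|p| < 1)
    (q_lam : cexp lam = q)
    (weight_generic : forall (k : nat) (P : {fset cell}) (c : cell),
       P \in placements k (ferrers n h) ->
       c \in uncancelled (ferrers n h) P ->
       weight_den a b q p (weight_arg P c) != 0)
    (lhs_generic : forall j : nat, (1 <= j <= n)%N ->
       shifted_elliptic_den lam a b q p (j%:Z - 1) (z - j%:R + 1) != 0)
    (rhs_generic : forall i : nat, (1 <= i <= n)%N ->
       shifted_elliptic_den lam a b q p (i%:Z - 1 - (h i)%:Z)
         (z + (h i)%:R - i%:R + 1) != 0) :
  \sum_(0 <= k < n.+1)
     elliptic_rook a b q p (n - k) (ferrers n h) *
     \prod_(1 <= j < k.+1)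
        shifted_elliptic_number lam a b q p (j%:Z - 1) (z - j%:R + 1)
  = \prod_(1 <= i < n.+1)
      shifted_elliptic_number lam a b q p (i%:Z - 1 - (h i)%:Z)
        (z + (h i)%:R - i%:R + 1).
Proof.
pose S j := shifted_elliptic_number lam a b q p (j%:Z - 1) (z - j%:R + 1).
pose T i := shifted_elliptic_number lam a b q p (i%:Z - 1 - (h i)%:Z)
  (z + (h i)%:R - i%:R + 1).
rewrite (elliptic_rook_sum a b q p n h S) -[RHS]/(\prod_(1 <= i < n.+1) T i).
suff : forall m, (m <= n)%N ->
  rook_sum (weight a b q p) h S m = \prod_(1 <= i < m.+1) T i by apply.
elim=> [_|m IH mn]; first by rewrite rook_sum0 big_geq.
rewrite [RHS]big_nat_recr //= -IH ?(ltnW mn) //; apply: rook_sumS => P PB.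
have hmono i : (1 <= i <= m)%N -> (h i <= h m.+1)%N.
  by move=> /andP[i1 im]; apply: h_mono => //; exact: leqW.
have Pm := card_placement PB.
set free := [pred j | j \notin occupied_rows P].
(* [E i] is E_(s+i), with i counting free rows: i = 0 gives the new factor on the right, i = [fa 0]
   the new factor [S] on the left. *)
pose s : int := m%:Z - (h m.+1)%:Z.
pose fa := free_above (h m.+1) free.
pose E i := elliptic_factor a b q p lam z (s + i%:Z).
have Pfa : (#|` P|%fset + fa 0 = h m.+1)%N.
  rewrite -[RHS]subn0 -(rooks_above hmono PB) //; congr (_ + _)%N.
  rewrite -[LHS]count_predT; apply: eq_in_count => d dP.
  move: PB; rewrite mem_nonattacking_placements => /andP[/fsubsetP/(_ _ dP)].
  by rewrite mem_ferrers => /andP[_ /andP[-> _]].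
have kE : s + (fa 0)%:Z = (m - #|` P|%fset)%N%:Z.
  by rewrite /s -Pfa -subzn // PoszD; ring.
have jE : (m - #|` P|%fset).+1%:Z - 1 = s + (fa 0)%:Z.
  by rewrite kE -addn1 PoszD addrK.
have zE : z - (m - #|` P|%fset).+1%:R + 1 = z - (s + (fa 0)%:Z)%:~R.
  by rewrite kE -[_.+1]addn1 natrD; ring.
have SE : S (m - #|` P|%fset).+1 = E (fa 0) by rewrite /S jE zE.
have TE : T m.+1 = E 0.
  rewrite /T /E /elliptic_factor.
  have -> : m.+1%:Z - 1 - (h m.+1)%:Z = s + 0 by rewrite /s; lia.
  congr (shifted_elliptic_number _ _ _ _ _ _ _).
  by rewrite addr0 /s intrB -[m.+1]addn1 natrD; ring.
(* This yields the nonvanishing of the three denominator factors that do not depend on the shift. *)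
have := rhs_generic m.+1 mn.
have -> : m.+1%:Z - 1 - (h m.+1)%:Z = s by rewrite /s; lia.
have -> : z + (h m.+1)%:R - m.+1%:R + 1 = z - s%:~R.
  by rewrite /s intrB -[m.+1]addn1 natrD; ring.
rewrite (shifted_elliptic_denE _ _ _ _ q_lam) // !mulf_eq0 !negb_or.
move=> /andP[/andP[thq _] /andP[th1 th2]].
(* The cell (m+1, t) in a free row is uncancelled by [P] on the full board too, so genericity of the
   weights applies. *)
have den_arg t : (0 < t <= h m.+1)%N -> free t ->
    weight_den a b q p (s + (fa t)%:Z + 1) != 0.
  move=> /andP[t0 th] ft; rewrite /s -(column_weight_arg hmono PB th).
  apply: (weight_generic #|` P|%fset).
    rewrite mem_placements eqxx andbT mem_nonattacking_placements.
    move: PB; rewrite mem_nonattacking_placements => /andP[/fsubsetP PB ->].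
    rewrite andbT; apply/fsubsetP => d /PB.
    rewrite !mem_ferrers => /andP[/andP[-> dm] ->].
    by rewrite (leq_trans dm) // ltnW.
  rewrite mem_uncancelled mem_ferrers /= mn t0 th (last_col_notin t PB) /=.
  apply/hasPn => d dP; have /andP[_ dm] := placement_col PB dP.
  rewrite /cancels /= negb_or !negb_and (ltn_eqF (dm : d.1 < m.+1)%N) /= andbT.
  apply/orP; left; apply: contraNneq ft => <-; exact: map_f.
(* At [fa 0] this is a factor of a left-hand denominator; at a free row it is the first theta factor
   of the weight denominator. *)
have Q t : (t <= h m.+1)%N -> theta1 p (a * q ^ (2 * (s + (fa t)%:Z) + 1)) != 0.
  apply: (free_above_ind (Q := fun i =>
    is_true (theta1 p (a * q ^ (2 * (s + i%:Z) + 1)) != 0))).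
    have := lhs_generic (m - #|` P|%fset).+1.
    rewrite jE zE.
    rewrite (shifted_elliptic_denE _ _ _ _ q_lam) // !mulf_eq0 !negb_or.
    by move=> /(_ (leq_trans (leq_subr _ _ : (m - _ < m.+1)%N) mn)) /andP[/andP[_ ->]].
  move=> u uh fu; have := den_arg u uh fu.
  rewrite /weight_den /theta !big_cons mulf_eq0 negb_or => /andP[+ _].
  by have -> : 2 * (s + (fa u)%:Z + 1) - 1 = 2 * (s + (fa u)%:Z) + 1 by ring.
rewrite SE TE; apply: column_telescope => // t tf ft.
have /andP[t0 th] := tf.
rewrite /column_weight (column_weight_arg hmono PB th) -/s -/fa -/free.
rewrite -/fa /E (elliptic_factor_rec a_neq0 b_neq0 p_lt1 q_lam) //.
- by have -> : s + (fa t)%:Z + 1 = s + (fa t).+1%:Z by rewrite -[_.+1]addn1 PoszD addrA.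
- exact: Q.
(* As row t is free, the count at t-1 is [fa t] + 1. *)
- have := Q t.-1; rewrite /fa free_above_pred prednK //.
  rewrite (_ : free t) // => /(_ (leq_trans (leq_pred _) th)).
  by rewrite addnC PoszD addrA.
- exact: den_arg.
Qed.
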